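(* Let $n\ge 1$. Suppose that $f:\mathbb{R}^n\to[0,\infty]$ is a function (not assumed Lebesgue measurable) such that $\int_B f(y)\,d\tilde{\mathcal H}^n_\infty(y)<\infty$ for all open balls $B$ in $\mathbb{R}^n$. Then $f$ is Lebesgue measurable if and only if $$f(x)=\limsup_{r\to 0^+}\frac{1}{\tilde{\mathcal H}^n_\infty(B(x,r))}\int_{B(x,r)} f(y)\,d\tilde{\mathcal H}^n_\infty(y)$$ for $\tilde{\mathcal H}^n_\infty$-almost every $x\in\mathbb{R}^n$.
   Context: Dyadic cubes: for $k\in\mathbb{Z}$ let $\mathcal Q_k$ be the collection of half-open cubes $Q$ with vertices in the lattice $(2^k\mathbb{Z})^n$, each a translate of $[0,2^k)^n$; its side length is $\ell(Q)=2^k$. Dyadic cubes are the elements of $\bigcup_{k\in\mathbb{Z}}\mathcal Q_k$. Dyadic Hausdorff content: for $\delta\in(0,n]$ and any $E\subset\mathbb{R}^n$, $\tilde{\mathcal H}^\delta_\infty(E):=\inf\{\sum_{i}\ell(Q_i)^\delta : E\subset \operatorname{int}(\bigcup_{i}Q_i)\}$, the infimum being over all countable (or finite) collections of dyadic cubes $Q_i$. Here $\delta=n$. Choquet integral: for any set $\Omega\subset\mathbb{R}^n$ and any function $f:\Omega\to[0,\infty]$ (no measurability required), $\int_\Omega f\,d\tilde{\mathcal H}^\delta_\infty:=\int_0^\infty\tilde{\mathcal H}^\delta_\infty(\{x\in\Omega: f(x)>t\})\,dt$. ''For $\tilde{\mathcal H}^\delta_\infty$-almost every $x$'' means outside a set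 $E$ with $\tilde{\mathcal H}^\delta_\infty(E)=0$. $B(x,r)$ denotes the open ball with centre $x$ and radius $r$. *)

(* Defs.v *)
From HB Require Import structures.
From mathcomp Require Import all_boot all_order all_algebra.
From mathcomp Require Import all_classical all_reals all_analysis.
From mathcomp Require Import measurable_realfun.
Import Order.TTheory GRing.Theory Num.Theory.
Import numFieldNormedType.Exports.

Set Implicit Arguments.
Unset Strict Implicit.
Unset Printing Implicit Defensive.

Local Open Scope classical_set_scope.
Local Open Scope ring_scope.
Local Open Scope ereal_scope.

Section euclidean_balls.
Context {R : realType} {n : nat}.

(* The library's norm on 'rV[R]_n is the sup norm; its [ball]s are cubes. *)
Definition euclid_dist (x y : 'rV[R]_n) : R :=
  Num.sqrt (\sum_(i < n) (x ord0 i - y ord0 i) ^+ 2)%R.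

Definition euclid_ball (x : 'rV[R]_n) (r : R) : set 'rV[R]_n :=
  [set y | (euclid_dist x y < r)%R].

End euclidean_balls.

Section dyadic_content.
Context {R : realType} {n : nat}.

(* A dyadic cube is encoded by its generation k and by the lattice point 2^k m
   that is its lower-left vertex. *)
Definition dyadic_index : Type := int * ('I_n -> int).

Definition side_length (q : dyadic_index) : R := ((2 : R) ^ q.1)%R.

Definition dyadic_cube (q : dyadic_index) : set 'rV[R]_n :=
  [set x | forall i : 'I_n,
     (side_length q * (q.2 i)%:~R <= x ord0 i
        < side_length q * (q.2 i)%:~R + side_length q)%R].

(* A finite or countable collection of cubes is a family indexed by a subset D
   of nat. *)
Definition dyadic_content (delta : R) (E : set 'rV[R]_n) : \bar R :=
  ereal_inf [set s | exists (D : set nat) (Q : nat -> dyadic_index),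
    E `<=` (\bigcup_(i in D) dyadic_cube (Q i))° /\
    s = \esum_(i in D) (side_length (Q i) `^ delta)%:E].

Definition content_ae (delta : R) (P : 'rV[R]_n -> Prop) : Prop :=
  exists E : set 'rV[R]_n,
    dyadic_content delta E = 0 /\ forall x, ~ E x -> P x.

Definition choquet_integral (delta : R) (Omega : set 'rV[R]_n)
    (f : 'rV[R]_n -> \bar R) : \bar R :=
  \int[lebesgue_measure]_(t in `]0%R, +oo[%classic)
    dyadic_content delta (Omega `&` [set x | t%:E < f x]).

End dyadic_content.

Section lebesgue_outer.
Context (R : realType) (n : nat).

Definition box (c : 'rV[R]_n * 'rV[R]_n) : set 'rV[R]_n :=
  [set x | forall i : 'I_n, (c.1 ord0 i <= x ord0 i < c.2 ord0 i)%R].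

(* A box with c.2 <= c.1 in some coordinate is empty and has volume 0. *)
Definition box_volume (c : 'rV[R]_n * 'rV[R]_n) : R :=
  (\prod_(i < n) Num.max 0 (c.2 ord0 i - c.1 ord0 i))%R.

Definition lebesgue_outer (E : set 'rV[R]_n) : \bar R :=
  ereal_inf [set s | exists (D : set nat) (C : nat -> 'rV[R]_n * 'rV[R]_n),
    E `<=` \bigcup_(i in D) box (C i) /\
    s = \esum_(i in D) (box_volume (C i))%:E].

Let box_volume_ge0 c : 0 <= (box_volume c)%:E.
Proof. by rewrite lee_fin prodr_ge0// => i _; rewrite le_max lexx. Qed.

Let lebesgue_outer_ge0 E : 0 <= lebesgue_outer E.
Proof.
by apply: le_ereal_inf_tmp => _ [D [C [_ ->]]]; exact: esum_ge0.
Qed.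

Let lebesgue_outer0 : lebesgue_outer set0 = 0.
Proof.
apply/eqP; rewrite eq_le lebesgue_outer_ge0 andbT.
apply: ereal_inf_lbound; exists set0, (fun=> (0, 0)%R); split=> //.
by rewrite esum_set0.
Qed.

Let le_lebesgue_outer : {homo lebesgue_outer : A B / A `<=` B >-> A <= B}.
Proof.
move=> A B AB; apply: ereal_inf_le_tmp => _ [D [C [BC ->]]].
by exists D, C; split=> //; exact: subset_trans AB BC.
Qed.

Let lebesgue_outer_sigma_subadditive : sigma_subadditive lebesgue_outer.
Proof.
move=> A; have [[i ioo]|] := pselect (exists i, lebesgue_outer (A i) = +oo).
  rewrite (eseries_pinfty _ _ ioo) ?leey// => m _.
  by rewrite -ltNye (lt_le_trans _ (lebesgue_outer_ge0 _)).
rewrite -forallNE => Aoo.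
apply/lee_addgt0Pr => _/posnumP[e].
rewrite (le_trans _ (epsilon_trick _ _ _))//.
pose P m (p : set nat * (nat -> 'rV[R]_n * 'rV[R]_n)) :=
  A m `<=` \bigcup_(i in p.1) box (p.2 i) /\
  \esum_(i in p.1) (box_volume (p.2 i))%:E <=
    lebesgue_outer (A m) + (e%:num / (2 ^ m.+1)%:R)%:E.
have [G PG] : {G & forall m, P m (G m)}.
  apply: (@choice _ _ P) => m.
  have en1 : (0 < e%:num / (2 ^ m.+1)%:R :> R)%R by [].
  have fin : lebesgue_outer (A m) \is a fin_num.
    by rewrite ge0_fin_numE// ltey; apply/eqP; exact: Aoo.
  have [_ [D [C [AC ->]]] lt] := lb_ereal_inf_adherent en1 fin.
  by exists (D, C); split=> //=; exact: ltW.
have /card_esym/ppcard_eqP[f] := card_nat2.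
pose J : set (nat * nat) := [set: nat] `*`` (fun i => (G i).1).
apply: (@le_trans _ _
  (\esum_(i in f @^-1` J) (box_volume ((G (f i).1).2 (f i).2))%:E)).
  apply: ereal_inf_lbound; exists (f @^-1` J).
  exists (fun i => (G (f i).1).2 (f i).2); split=> // t [i _ Ait].
  have [j Dj Bt] := (PG i).1 t Ait.
  by exists (f^-1%FUN (i, j)); rewrite /J /= invK ?inE.
have bijf : set_bij (f @^-1` J) J f.
  split=> [//|i j _ _ eqf|p Jp].
    by apply: (@inj _ _ _ f) eqf; rewrite inE.
  by exists (f^-1%FUN p); rewrite /= invK ?inE.
rewrite -(@reindex_esum _ _ _ _ _ _
  (fun p => (box_volume ((G p.1).2 p.2))%:E) bijf).
rewrite -(@esum_esum _ _ _ setT (fun i => (G i).1)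
  (fun i j => (box_volume ((G i).2 j))%:E))//.
rewrite -nneseries_esumT//; last by move=> m; exact: esum_ge0.
apply: lee_nneseries => m _.
  by move=> _; exact: esum_ge0.
by have [] := PG m.
Qed.

HB.instance Definition _ := isOuterMeasure.Build R 'rV[R]_n lebesgue_outer
  lebesgue_outer0 lebesgue_outer_ge0 le_lebesgue_outer
  lebesgue_outer_sigma_subadditive.

End lebesgue_outer.

(* [caratheodory_type] is 'rV[R]_n with the sigma-algebra of the sets that are
   Caratheodory measurable for [lebesgue_outer]; the codomain is Borel. *)
Definition lebesgue_measurable_fun (R : realType) (n : nat)
    (f : 'rV[R]_n -> \bar R) : Prop :=
  measurable_fun [set: caratheodory_type (@lebesgue_outer R n)]
    (f : caratheodory_type (@lebesgue_outer R n) -> \bar R).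

(* Main.v *)
(* The dyadic content of dimension n is Lebesgue outer measure mu: a box is
   covered, interior included, by the cubes of one fine generation that meet it,
   and these are disjoint with volumes adding up to little more than the box.
   If f is measurable, Lebesgue differentiation applies separately to each
   rational level q: the part of f above q gives an integral carrying no mass on
   {f <= q}, and the restriction of mu to {f < q} gives no mass to {f >= q}, so
   by a Vitali argument the averages of these vanish almost everywhere on those
   sets; hence the averages of f tend to f.  Conversely, for arbitrary f the
   integral over B(x, r) is lower semicontinuous in x, since mu is continuous
   along increasing unions of balls even when restricted to a nonmeasurable
   set; so the limsup is a Borel function of x, and f agrees with it outside a
   null set. *)
From HB Require Import structures.
Require Import Defs.
From mathcomp Require Import all_boot all_order all_algebra finmap.
From mathcomp Require Import all_classical all_reals all_analysis.
From mathcomp Require Import measurable_realfun lra.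
Import Order.TTheory GRing.Theory Num.Theory.
Import numFieldNormedType.Exports.

Set Implicit Arguments.
Unset Strict Implicit.
Unset Printing Implicit Defensive.

Local Open Scope classical_set_scope.
Local Open Scope ring_scope.
Local Open Scope ereal_scope.

(** * Countable reindexing, measurability criteria and the covering inequality for boxes *)

Section countable_families.
Context {R : realType}.

(** Brings a countable family over any index type into the form in which covers are defined, a
    family over a subset of [nat]. The point [i0] gives the inverse of an injection into [nat] a
    default value. *)
Lemma countable_enum (I : choiceType) (i0 : I) (D : set I) : countable D ->
  exists (N : set nat) (e : nat -> I), set_bij N D e.
Proof.
move=> /countable_injP[f injf].
pose I' : pointedType := HB.pack (I : Type) I (isPointed.Build I i0).
exists (f @` D), (pinv (D : set I') f).
by apply: bijpinv_bij; exact: inj_bij.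
Qed.

Lemma emeasurable_fun_gt d (T : measurableType d) (D : set T)
    (h : T -> \bar R) :
  (forall a : R, measurable (D `&` [set x | a%:E < h x])) -> measurable_fun D h.
Proof.
move=> mh; apply: (measurability _ (ErealGenOInfty.measurableE R)).
by move=> /= _ [_ [a ->]] <-; rewrite preimage_itvoy.
Qed.

(** Superlevel sets are closed downwards, hence intervals. This makes every Choquet integrand
    measurable, whatever the integrated function. *)
Lemma nonincreasing_emeasurable (D : set R) (h : R -> \bar R) :
  measurable D -> {homo h : x y / (x <= y)%R >-> y <= x} -> measurable_fun D h.
Proof.
move=> mD nh; apply: emeasurable_fun_gt => a; apply: measurableI => //.
apply: is_interval_measurable => s t /= _ at_ u /andP[_ /nh].
exact: lt_le_trans.
Qed.

(* Slicing along the last coordinate reduces to dimension [m]; Lebesgue measure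
   on the line then integrates the slice inequality. *)
Lemma prod_le_cover_volume (m : nat) (D : set nat) (a b : nat -> nat -> R)
    (A B : nat -> R) :
  (forall j, A j <= B j)%R ->
  (forall x : nat -> R, (forall j, (j < m)%N -> A j <= x j < B j)%R ->
     exists2 i, D i & forall j, (j < m)%N -> (a i j <= x j < b i j)%R) ->
  (\prod_(j < m) (B j - A j))%:E <=
  \esum_(i in D) (\prod_(j < m) Num.max 0 (b i j - a i j))%R%:E.
Proof.
move=> AB; elim: m D => [|m ih] D cov.
  (* In dimension 0 all products are empty and equal 1, so one box in the cover is enough. *)
  have [//|i Di _] := cov A.
  apply: esum_ge; exists [set i].
    by split=> // j ->.
  by rewrite fsbig_set1 !big_ord0.
pose v i := (\prod_(j < m) Num.max 0 (b i j - a i j))%R.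
have v0 i : (0 <= v i)%R by rewrite prodr_ge0// => j _; rewrite le_max lexx.
pose P := (\prod_(j < m) (B j - A j))%R.
have P0 : (0 <= P)%R by rewrite prodr_ge0// => j _; rewrite subr_ge0.
pose I i := `[a i m, b i m[%classic.
pose L := `[A m, B m[%classic.
(* The share of box [i] in the slice at height [t]; indices outside [D] contribute 0, so that a
   series over all of [nat] can be integrated. *)
pose w i (t : R) : \bar R := if i \in D then (v i)%:E * (\1_(I i) t)%:E else 0.
have w0 i t : 0 <= w i t.
  by rewrite /w; case: ifP => // _; rewrite mule_ge0// lee_fin.
have slice t : L t -> P%:E <= \sum_(i <oo) w i t.
  move=> Lt; rewrite nneseries_esumT//.
  apply: (@le_trans _ _ (\esum_(i in [set i | D i /\ I i t]) (v i)%:E)).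
    apply: ih => x xAB.
    have [j|i Di abi] := cov (fun j => if j == m then t else x j).
      rewrite ltnS leq_eqVlt => /orP[/eqP ->|jm].
        by rewrite eqxx; move: Lt; rewrite /L/= in_itv.
      by rewrite ltn_eqF// xAB.
    exists i; first split=> //.
      by have := abi m (ltnSn m); rewrite eqxx /I/= in_itv.
    by move=> j jm; have := abi j (ltnW jm); rewrite ltn_eqF.
  rewrite esum_mkcond; apply: le_esum => i _; rewrite /w.
  case: ifPn => [|_]; last exact: w0.
  by rewrite inE => -[Di Iit]; rewrite mem_set// indicE mem_set// mule1.
have mI i : measurable (I i) by exact: measurable_itv.
have m1 i : measurable_fun L (fun t : R => (\1_(I i) t)%:E : \bar R).
  by apply/measurable_EFinP; exact: measurable_indic.
have mw i : measurable_fun L (w i).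
  rewrite /w; case: (i \in D); last exact: measurable_cst.
  exact: measurable_funeM.
have mL : measurable L by exact: measurable_itv.
have muL : lebesgue_measure L = (B m - A m)%:E.
  rewrite /L lebesgue_measure_itv/= lte_fin; case: ltP => // BA.
  by have /eqP -> : A m == B m; [rewrite eq_le AB BA|rewrite subrr].
apply: (@le_trans _ _ (\int[lebesgue_measure]_(t in L) (\sum_(i <oo) w i t))).
  rewrite big_ord_recr/= EFinM -/P -muL.
  rewrite [leLHS](_ : _ = \int[lebesgue_measure]_(t in L) (cst P%:E t)); last first.
    by rewrite integral_cst.
  apply: ge0_le_integral => //.
  by apply: ge0_emeasurable_sum => [i t _ _|i _]; [exact: w0|exact: mw].
rewrite integral_nneseries// nneseries_esumT; last first.
  by move=> i; apply: integral_ge0 => t _; exact: w0.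
rewrite [leRHS]esum_mkcond; apply: le_esum => i _.
rewrite /w; case: (i \in D); last first.
  by rewrite integral0 lexx.
rewrite (_ : \int[_]_(_ in _) _ =
    (v i)%:E * \int[lebesgue_measure]_(t in L) (\1_(I i) t)%:E); last first.
  apply: ge0_integralZl; rewrite ?lee_fin//.
  exact: m1.
rewrite (_ : \int[_]_(_ in _) _ = lebesgue_measure (I i `&` L)); last first.
  by apply: integral_indic; [exact: mL|exact: mI].
rewrite big_ord_recr/= EFinM lee_pmul//.
  by rewrite lee_fin.
apply: (@le_trans _ _ (lebesgue_measure (I i))).
  apply: le_measure; rewrite ?inE; last exact: subIsetl.
    exact: (measurableI _ _ (mI i) mL).
  exact: mI.
rewrite /I lebesgue_measure_itv/= lte_fin EFin_max; case: ltP => // _.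
  by rewrite le_max -EFinB lexx orbT.
by rewrite le_max lexx.
Qed.

End countable_families.

(** * Boxes and Lebesgue outer measure *)

Section outer_measure_families.
Context {R : realType} {T : Type} (mu : {outer_measure set T -> \bar R}).

Lemma outer_measure_countable (I : choiceType) (i0 : I) (D : set I)
    (F : I -> set T) : countable D ->
  mu (\bigcup_(i in D) F i) <= \esum_(i in D) mu (F i).
Proof.
move=> /(countable_enum i0)[N [e [eN einj eD]]].
have -> : \bigcup_(i in D) F i =
    \bigcup_k (if k \in N then F (e k) else set0).
  apply/seteqP; split=> [x [i Di Fix]|x [k _]].
    have [k Nk eki] := eD i Di.
    by exists k => //; rewrite mem_set// eki.
  case: ifPn => //; rewrite inE => Nk Fx; exists (e k) => //.
  exact: eN.
apply: (le_trans (outer_measure_sigma_subadditive mu _)).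
rewrite nneseries_esumT; last by move=> k; exact: outer_measure_ge0.
rewrite (reindex_esum N D e)// [leRHS]esum_mkcond; apply: le_esum => k _.
by case: ifP => //; rewrite outer_measure0.
Qed.

(** A Caratheodory set splits [S] exactly, so the pieces can be removed one at a time. The set [S]
    stays arbitrary; later it is a superlevel set of a possibly nonmeasurable function. *)
Lemma sum_outer_measure_le (I : eqType) (s : seq I) (F : I -> set T)
    (U S : set T) : uniq s ->
  (forall i, i \in s -> mu.-caratheodory (F i)) ->
  (forall i j, i \in s -> j \in s -> i != j -> F i `&` F j = set0) ->
  (forall i, i \in s -> F i `<=` U) ->
  \sum_(i <- s) mu (S `&` F i) <= mu (S `&` U).
Proof.
elim: s U => [|i s ih] U.
  by rewrite big_nil => _ _ _ _; exact: outer_measure_ge0.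
rewrite cons_uniq => /andP[is_ us] mF dF FU; rewrite big_cons.
rewrite (mF i _ (S `&` U)) ?mem_head//; apply: leeD.
  apply: le_outer_measure => x [Sx Fx]; split=> //; split=> //.
  by apply: FU Fx; rewrite mem_head.
rewrite -setIA; apply: ih => //.
- by move=> j js; apply: mF; rewrite in_cons js orbT.
- by move=> j k js ks; apply: dF; rewrite in_cons ?js ?ks orbT.
- move=> j js x Fjx; split.
    by apply: FU Fjx; rewrite in_cons js orbT.
  move=> Fix.
  have : (F i `&` F j) x by [].
  rewrite dF ?mem_head//.
    by rewrite in_cons js orbT.
  by apply: contraNneq is_ => ->.
Qed.

Lemma esum_outer_measure_le (I : choiceType) (D : set I) (F : I -> set T)
    (U S : set T) :
  (forall i, D i -> mu.-caratheodory (F i)) ->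
  trivIset D F ->
  (forall i, D i -> F i `<=` U) ->
  \esum_(i in D) mu (S `&` F i) <= mu (S `&` U).
Proof.
move=> mF /trivIsetP tF FU; apply: ge_ereal_sup => _ [X [finX XD] <-].
have inX (i : I) : i \in fset_set X -> D i.
  by rewrite in_fset_set// inE => /XD.
rewrite fsbig_finite//; apply: sum_outer_measure_le => //.
- by move=> i /inX; exact: mF.
- by move=> i j /inX Di /inX; exact: tF.
- by move=> i /inX; exact: FU.
Qed.

End outer_measure_families.

Section boxes.
Context {R : realType} {n : nat}.
Local Notation mu := (@lebesgue_outer R n).

Lemma box_volume_ge0 (c : 'rV[R]_n * 'rV[R]_n) : (0 <= box_volume c)%R.
Proof. by rewrite prodr_ge0// => i _; rewrite le_max lexx. Qed.

Lemma lebesgue_outer_le_cover (I : choiceType) (i0 : I) (D : set I)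
    (C : I -> 'rV[R]_n * 'rV[R]_n) (E : set 'rV[R]_n) :
  countable D -> E `<=` \bigcup_(i in D) box (C i) ->
  mu E <= \esum_(i in D) (box_volume (C i))%:E.
Proof.
move=> /(countable_enum i0)[N [e Ne]] EC; apply: ereal_inf_lbound.
have [eN einj eD] := Ne.
exists N, (C \o e); split.
  move=> x /EC[i Di Cx]; have [k Nk eki] := eD i Di.
  by exists k => //=; rewrite eki.
by rewrite (reindex_esum N D e).
Qed.

Lemma lebesgue_outer_box_le (c : 'rV[R]_n * 'rV[R]_n) :
  mu (box c) <= (box_volume c)%:E.
Proof.
rewrite -(@esum_set1 _ _ tt (fun=> (box_volume c)%:E)).
  apply: (lebesgue_outer_le_cover tt (C := fun=> c)) => //.
  by move=> x cx; exists tt.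
by rewrite lee_fin box_volume_ge0.
Qed.

Lemma lebesgue_outer_box_ge (c : 'rV[R]_n * 'rV[R]_n) :
  (box_volume c)%:E <= mu (box c).
Proof.
(* A box degenerate in some coordinate has volume 0; for the others the endpoints are ordered, as
   the covering inequality requires. *)
have [[i ci]|] := pselect (exists i, c.2 ord0 i <= c.1 ord0 i)%R.
  rewrite /box_volume (bigD1 i)//= max_l ?subr_le0// mul0r.
  exact: outer_measure_ge0.
move=> /forallNP c12.
have {}c12 i : (c.1 ord0 i <= c.2 ord0 i)%R.
  by have /negP := c12 i; rewrite -ltNge => /ltW.
apply: le_ereal_inf_tmp => _ [D [C [cC ->]]].
(* Row vectors become sequences, extended by 0, to fit the covering inequality. *)
pose co (v : 'rV[R]_n) (j : nat) : R :=
  if insub j is Some i then v ord0 i else 0%R.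
have coE v (i : 'I_n) : co v i = v ord0 i by rewrite /co valK.
have co_row v j (jn : (j < n)%N) : co v j = v ord0 (Ordinal jn).
  by rewrite -coE.
have := @prod_le_cover_volume R n D (fun i => co (C i).1) (fun i => co (C i).2)
  (co c.1) (co c.2).
have -> : (\prod_(j < n) (co c.2 j - co c.1 j))%R = box_volume c.
  by apply: eq_bigr => i _; rewrite !coE max_r// subr_ge0.
have -> : \esum_(i in D)
    (\prod_(j < n) Num.max 0 (co (C i).2 j - co (C i).1 j))%R%:E =
    \esum_(i in D) (box_volume (C i))%:E.
  apply: eq_esum => i _; congr EFin; apply: eq_bigr => j _.
  by rewrite !coE.
apply.
  by move=> j; rewrite /co; case: insubP.
move=> x xc.
have [|i Di Ci] := cC (\row_(j < n) x j)%R.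
  by move=> j; rewrite mxE -!coE; exact: xc.
exists i => // j jn; rewrite !co_row.
by have := Ci (Ordinal jn); rewrite mxE.
Qed.

Lemma lebesgue_outer_box (c : 'rV[R]_n * 'rV[R]_n) :
  mu (box c) = (box_volume c)%:E.
Proof.
by apply/eqP; rewrite eq_le lebesgue_outer_box_le lebesgue_outer_box_ge.
Qed.

(** Lengths of the parts of [[a, b)] on either side of [s], an empty part counting 0. *)
Lemma split_length (a b s : R) :
  (Num.max 0 (Num.min b s - a) + Num.max 0 (b - Num.max a s) <=
   Num.max 0 (b - a))%R.
Proof.
have [bs|sb] := lerP b s; have [as_|sa] := lerP a s.
- rewrite [X in (_ + X <= _)%R]max_l ?addr0//; lra.
- rewrite [X in (_ + X <= _)%R]max_l ?addr0//; lra.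
- rewrite !max_r; lra.
- rewrite [X in (X + _ <= _)%R]max_l ?add0r//; lra.
Qed.

(* The hyperplane cuts each covering box into two boxes whose volumes add up. *)
Lemma halfspace_caratheodory (j : 'I_n) (s : R) :
  mu.-caratheodory [set x : 'rV[R]_n | x ord0 j < s]%R.
Proof.
apply: le_caratheodory_measurable => X.
apply: le_ereal_inf_tmp => _ [D [C [XC ->]]].
pose lo (c : 'rV[R]_n * 'rV[R]_n) := (c.1,
  \row_i (if i == j then Num.min (c.2 ord0 i) s else c.2 ord0 i))%R.
pose hi (c : 'rV[R]_n * 'rV[R]_n) :=
  ((\row_i (if i == j then Num.max (c.1 ord0 i) s else c.1 ord0 i))%R, c.2).
have lohi c : (box_volume (lo c) + box_volume (hi c) <= box_volume c)%R.
  have volE d : box_volume d = (Num.max 0 (d.2 ord0 j - d.1 ord0 j) *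
      \prod_(i < n | i != j) Num.max 0 (d.2 ord0 i - d.1 ord0 i))%R.
    by rewrite /box_volume (bigD1 j).
  rewrite !volE !mxE eqxx.
  rewrite (eq_bigr (fun i => Num.max 0 (c.2 ord0 i - c.1 ord0 i))%R); last first.
    by move=> i /negbTE ij; rewrite !mxE ij.
  rewrite [X in (_ + _ * X)%R](eq_bigr
      (fun i => Num.max 0 (c.2 ord0 i - c.1 ord0 i))%R); last first.
    by move=> i /negbTE ij; rewrite !mxE ij.
  rewrite -mulrDl ler_wpM2r//.
    by rewrite prodr_ge0// => i _; rewrite le_max lexx.
  exact: split_length.
apply: (@le_trans _ _ (\esum_(i in D) (box_volume (lo (C i)))%:E +
    \esum_(i in D) (box_volume (hi (C i)))%:E)).
  apply: leeD; apply: (lebesgue_outer_le_cover 0%N); [exact: countableP| |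
      exact: countableP|] => x [/XC[i Di Cx] xs]; exists i => // k; rewrite /= mxE;
      have /andP[ak bk] := Cx k; case: eqP => [kj|_]; rewrite ?ak ?bk//.
    by rewrite lt_min bk kj.
  by rewrite ge_max ak kj leNgt andbT; apply/negP.
rewrite -esumD; last 2 first.
- by move=> i _; rewrite lee_fin box_volume_ge0.
- by move=> i _; rewrite lee_fin box_volume_ge0.
by apply: le_esum => i _; rewrite -EFinD lee_fin lohi.
Qed.

(** A box is a finite intersection of open half-spaces and complements of such. *)
Lemma box_caratheodory (c : 'rV[R]_n * 'rV[R]_n) : mu.-caratheodory (box c).
Proof.
have -> : box c = \big[setI/setT]_(i < n)
    ((~` [set x | x ord0 i < c.1 ord0 i]%R) `&`
     [set x | x ord0 i < c.2 ord0 i]%R).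
  rewrite -bigcap_seq; apply/seteqP; split=> x cx i.
    by move=> _; have /andP[ai bi] := cx i; split=> //=; apply/negP; rewrite -leNgt.
  by have [/= /negP] := cx i (mem_index_enum i); rewrite -leNgt => -> ->.
elim/big_ind: _ => [|A B mA mB|i _].
- rewrite -setC0; apply: caratheodory_measurable_setC.
  exact: caratheodory_measurable_set0.
- exact: caratheodory_measurable_setI.
- apply: caratheodory_measurable_setI; last exact: halfspace_caratheodory.
  by apply: caratheodory_measurable_setC; exact: halfspace_caratheodory.
Qed.

End boxes.

(** * Dyadic content is Lebesgue outer measure *)

Section dyadic_cubes.
Context {R : realType} {n : nat}.
Local Notation mu := (@lebesgue_outer R n).
Local Notation J := (int * {ffun 'I_n -> int})%type.

(** Lattice points are encoded as finite functions, so that cubes are indexed by a countable type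
    and families of them can be enumerated. *)
Definition lattice_cube (p : J) : dyadic_index (n := n) :=
  (p.1, p.2 : 'I_n -> int).

Definition cube_box (q : dyadic_index) : 'rV[R]_n * 'rV[R]_n :=
  ((\row_i (side_length q * (q.2 i)%:~R))%R,
   (\row_i (side_length q * (q.2 i)%:~R + side_length q))%R).

Lemma side_length_gt0 (q : dyadic_index (n := n)) : (0 < side_length q :> R)%R.
Proof. by rewrite exprz_gt0. Qed.

Lemma dyadic_cube_box (q : dyadic_index) : dyadic_cube q = box (cube_box q).
Proof.
by apply/seteqP; split=> x qx i; have := qx i; rewrite !mxE.
Qed.

Lemma cube_volume (q : dyadic_index) :
  box_volume (cube_box q) = (side_length q ^+ n)%R.
Proof.
rewrite /box_volume (eq_bigr (fun=> side_length q)) => [|i _].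
  by rewrite prodr_const card_ord.
by rewrite !mxE addrAC subrr add0r max_r// ltW// side_length_gt0.
Qed.

Lemma cube_content (q : dyadic_index) :
  (side_length q `^ n%:R)%R = box_volume (cube_box q) :> R.
Proof. by rewrite cube_volume powR_mulrn// ltW// side_length_gt0. Qed.

Definition cube_around (k : int) (x : 'rV[R]_n) : J :=
  (k, [ffun i => Num.floor (x ord0 i / (2 : R) ^ k)])%R.

Lemma cube_aroundP k x : dyadic_cube (lattice_cube (cube_around k x)) x.
Proof.
move=> i; rewrite /side_length /= ffunE.
have h0 : (0 < (2 : R) ^ k)%R by rewrite exprz_gt0.
have /andP[fl] := floor_itv (x ord0 i / (2 : R) ^ k)%R; rewrite intrD => fr.
rewrite mulrC -ler_pdivlMr// fl/=.
by rewrite -[X in (_ + X)%R]mul1r -mulrDl -ltr_pdivrMr.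
Qed.

(** Uniqueness of the cube through [x] in a given generation; hence distinct cubes of one generation
    are disjoint. *)
Lemma cube_around_eq (p : J) x :
  dyadic_cube (lattice_cube p) x -> p = cube_around p.1 x.
Proof.
case: p => k m px; congr pair; apply/ffunP => i; rewrite ffunE.
have h0 : (0 < (2 : R) ^ k)%R by rewrite exprz_gt0.
apply/esym/floor_def; have := px i; rewrite /side_length/= => /andP[ml mr].
rewrite ler_pdivlMr// mulrC ml/= ltr_pdivrMr// intrD mulrDl mul1r.
by rewrite [X in (_ < X + _)%R]mulrC.
Qed.

Lemma cube_diam (p : J) (x y : 'rV[R]_n) i :
  dyadic_cube (lattice_cube p) x -> dyadic_cube (lattice_cube p) y ->
  (`|x ord0 i - y ord0 i| < 2 ^ p.1)%R.
Proof.
move=> /(_ i) px /(_ i); move: px.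
rewrite /side_length /= => /andP[xl xr] /andP[yl yr].
by rewrite ltr_norml; apply/andP; split; lra.
Qed.

Lemma row_ballP (x y : 'rV[R]_n) (r : R) : (0 < r)%R ->
  ball x r y <-> forall i, (`|x ord0 i - y ord0 i| < r)%R.
Proof.
move=> r0; split=> [[_ xy] i|xy]; first exact: xy.
by split=> // i j; rewrite ord1; exact: xy.
Qed.

Lemma small_scale (e : R) : (0 < e)%R -> exists k : int, ((2 : R) ^ k < e)%R.
Proof.
move=> e0; pose N := Num.bound e^-1.
have : (e^-1 < N%:R)%R by rewrite archi_boundP// invr_ge0 ltW.
have N2 : (N%:R < (2 : R) ^+ N)%R by rewrite -natrX ltr_nat ltn_expl.
move=> /lt_trans/(_ N2) eN; exists (- N%:Z)%R.
by rewrite -exprnN -[ltRHS]invrK ltf_pV2// posrE ?exprn_gt0 ?invr_gt0.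
Qed.

(** Each point of [U] lies in a small dyadic cube inside [U], so [U] is a countable union of dyadic
    cubes, which are boxes. *)
Lemma open_caratheodory (U : set 'rV[R]_n) : open U -> mu.-caratheodory U.
Proof.
move=> oU; pose D := [set p : J | dyadic_cube (lattice_cube p) `<=` U].
have [N [e [eN einj eD]]] := countable_enum (0%R, [ffun=> 0%R]) (countableP D).
have -> : U = \bigcup_k
    (if k \in N then dyadic_cube (lattice_cube (e k)) else set0).
  apply/seteqP; split=> [x Ux|x [k _]]; last first.
    by case: ifPn => //; rewrite inE => /eN; exact.
  move: (oU); rewrite openE => /(_ _ Ux); rewrite /interior -nbhs_ballE.
  move=> [r /= r0 xrU]; have [k kr] := small_scale r0.
  have [|j Nj ej] := eD (cube_around k x).
    move=> y ky; apply/xrU/row_ballP => // i.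
    by apply: lt_trans kr; apply: (cube_diam _ (cube_aroundP k x) ky).
  by exists j => //; rewrite mem_set// ej; exact: cube_aroundP.
apply: caratheodory_measurable_bigcup => k; case: ifP => _.
  by rewrite dyadic_cube_box; exact: box_caratheodory.
exact: caratheodory_measurable_set0.
Qed.

(** The volume depends continuously on the margin. The margin is [2 t] because one [t] makes room
    for the interior and another for the side of a cube that meets the enlarged box. *)
Lemma box_volume_enlarge (c : 'rV[R]_n * 'rV[R]_n) (e : R) : (0 < e)%R ->
  exists2 h : R, (0 < h)%R & forall t : R, (0 < t < h)%R ->
    (box_volume (c.1 - const_mx (t *+ 2), c.2 + const_mx (t *+ 2))
     <= box_volume c + e)%R.
Proof.
move=> e0.
pose V t := (\prod_(i < n) Num.max 0
  ((c.2 ord0 i + t *+ 2) - (c.1 ord0 i - t *+ 2)))%R.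
have V0 : V 0%R = box_volume c.
  by apply: eq_bigr => i _; rewrite mul0rn addr0 subr0.
have : V t @[t --> (0 : R)%R] --> V 0%R.
  apply: cvg_big => [|i _]; first exact: mul_continuous.
  apply: (@continuous_max _ _ (cst 0%R)
    (fun t => (c.2 ord0 i + t *+ 2) - (c.1 ord0 i - t *+ 2))%R); first exact: cvg_cst.
  by apply: cvgB; [apply: cvgD|apply: cvgB]; rewrite ?mulr2n;
     (exact: cvg_cst || (apply: cvgMn; exact: cvg_id)).
move/cvgrPdist_lt => /(_ e e0).
rewrite -nbhs_ballE => -[h /= h0 hV]; exists h => // t /andP[t0 th].
have /hV : ball (0 : R)%R h t by rewrite /ball/= sub0r normrN gtr0_norm.
rewrite /= V0 ltr_distlC => /andP[_ /ltW]; apply: le_trans.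
by rewrite le_eqVlt; apply/orP; left; apply/eqP; apply: eq_bigr => i _; rewrite !mxE.
Qed.

Lemma box_dyadic_cover (c : 'rV[R]_n * 'rV[R]_n) (e : R) : (0 < e)%R ->
  exists D : set J,
    box c `<=` (\bigcup_(p in D) dyadic_cube (R := R) (lattice_cube p))° /\
    \esum_(p in D) (box_volume (cube_box (lattice_cube p)))%:E <=
    (box_volume c + e)%:E.
Proof.
move=> e0; have [h h0 hV] := box_volume_enlarge c e0.
have [k kh] := small_scale h0; pose t : R := (2 ^ k)%R.
have t0 : (0 < t)%R by rewrite exprz_gt0.
(* Taking all cubes that meet this enlargement, rather than the box itself, covers a neighbourhood
   of the box. *)
pose B : set 'rV[R]_n :=
  [set x | forall i, c.1 ord0 i - t < x ord0 i < c.2 ord0 i + t]%R.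
pose D : set J :=
  [set p | p.1 = k /\ (dyadic_cube (lattice_cube p) `&` B) !=set0].
exists D; split.
  move=> x cx; rewrite /interior -nbhs_ballE; exists t => //= y.
  move=> /row_ballP-/(_ t0) xy; exists (cube_around k y); last exact: cube_aroundP.
  split=> //; exists y; split; first exact: cube_aroundP.
  move=> i; have := xy i; have := cx i; rewrite ltr_distl.
  by move=> /andP[? ?] /andP[? ?]; apply/andP; split; lra.
apply: (@le_trans _ _ (box_volume
    (c.1 - const_mx (t *+ 2), c.2 + const_mx (t *+ 2)))%:E)%R; last first.
  by rewrite lee_fin hV// t0.
(* Volumes become measures, so that disjointness of the cubes inside the enlarged box bounds their
   total. *)
rewrite -lebesgue_outer_box -[X in mu X]setTI.
under eq_esum do rewrite -lebesgue_outer_box -[X in mu X]setTI.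
apply: esum_outer_measure_le.
- by move=> p _; exact: box_caratheodory.
- apply/trivIsetP => p q [pk _] [qk _]; apply: contra_neqP.
  rewrite -!dyadic_cube_box => /eqP/set0P[x [/cube_around_eq -> /cube_around_eq ->]].
  by rewrite pk qk.
- move=> p [pk [x [px Bx]]] y; rewrite -dyadic_cube_box => py i.
  have := cube_diam i px py; have := Bx i; rewrite pk -/t !mxE ltr_distl.
  by move=> /andP[? ?] /andP[? ?]; apply/andP; split; lra.
Qed.

Lemma dyadic_contentE (E : set 'rV[R]_n) : dyadic_content n%:R E = mu E.
Proof.
apply/eqP; rewrite eq_le; apply/andP; split; last first.
  apply: le_ereal_inf_tmp => _ [D [Q [EQ ->]]].
  under eq_esum do rewrite cube_content.
  apply: (lebesgue_outer_le_cover 0%N); first exact: countableP.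
  move=> x /EQ/interior_subset[i Di Qx].
  by exists i => //; rewrite -dyadic_cube_box.
apply: le_ereal_inf_tmp => _ [D [C [EC ->]]].
apply/lee_addgt0Pr => _/posnumP[e].
(* The [i]-th box is replaced by dyadic cubes at a cost of [e / 2 ^ (i + 1)], and the resulting
   double family is enumerated. *)
have [G PG] := choice (fun i : nat =>
  @box_dyadic_cover (C i) (e%:num / (2 ^ i.+1)%:R)%R ltac:(by [])).
pose D' : set (nat * J) := D `*`` G.
have [N [f Nf]] := countable_enum (0%N, (0%R, [ffun=> 0%R])) (countableP D').
have [fN finj fD] := Nf.
apply: (@le_trans _ _
  (\esum_(p in D') (box_volume (cube_box (lattice_cube p.2)))%:E)).
  apply: ereal_inf_lbound; exists N, (fun i => lattice_cube (f i).2); split.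
    move=> x /EC[i Di Cx]; have := (PG i).1 x Cx; apply: interiorS.
    move=> y [p Gp py]; have [j Nj fj] := fD (i, p) (conj Di Gp).
    by exists j => //; rewrite fj.
  rewrite (reindex_esum N D' f)//; apply: eq_esum => i _.
  by rewrite cube_content.
rewrite -(@esum_esum _ _ _ D G
  (fun i p => (box_volume (cube_box (lattice_cube p)))%:E)); last first.
  by move=> i p _ _; rewrite lee_fin box_volume_ge0.
apply: (@le_trans _ _
  (\esum_(i in D) ((box_volume (C i))%:E + (e%:num / (2 ^ i.+1)%:R)%:E))).
  by apply: le_esum => i _; exact: (PG i).2.
rewrite esumD; last 2 first.
- by move=> i _; rewrite lee_fin box_volume_ge0.
- by move=> i _; rewrite lee_fin.
apply: leeD => //; rewrite esum_mkcond.
apply: (@le_trans _ _ (\esum_(i in [set: nat]) (e%:num / (2 ^ i.+1)%:R)%:E)).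
  by apply: le_esum => i _; case: ifP => _; rewrite lee_fin.
rewrite -nneseries_esumT; last by move=> i; rewrite lee_fin.
exact: epsilon_trick0.
Qed.

(** The dyadic content asks for covers by interiors, so the interior of a nearly optimal dyadic
    cover is the open set sought. *)
Lemma outer_open_approx (E : set 'rV[R]_n) (e : R) : (0 < e)%R ->
  mu E < +oo -> exists U, [/\ open U, E `<=` U & mu U <= mu E + e%:E].
Proof.
move=> e0 Eoo.
have fE : dyadic_content n%:R E \is a fin_num.
  by rewrite dyadic_contentE ge0_fin_numE// outer_measure_ge0.
have [_ [D [Q [EQ ->]]] QE] := lb_ereal_inf_adherent e0 fE.
exists (\bigcup_(i in D) dyadic_cube (Q i))°; split=> //.
  exact: open_interior.
rewrite -!dyadic_contentE; apply: le_trans (ltW QE).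
by apply: ereal_inf_lbound; exists D, Q; split.
Qed.

End dyadic_cubes.

(** * A Vitali argument *)

Section differentiation_of_null_parts.
Context {R : realType} {n : nat}.
Local Notation mu := (@lebesgue_outer R n).
Local Notation V := 'rV[R]_n.

Lemma outer_null_bigcup (I : countType) (i0 : I) (F : I -> set V) :
  (forall i, mu (F i) = 0) -> mu (\bigcup_i F i) = 0.
Proof.
move=> F0; apply/eqP; rewrite eq_le outer_measure_ge0 andbT.
apply: (le_trans (outer_measure_countable mu i0 F (countableP _))).
by rewrite esum1// => i _; exact: F0.
Qed.

Lemma le_outer_null (A B : set V) : A `<=` B -> mu B = 0 -> mu A = 0.
Proof.
move=> AB B0; apply/eqP; rewrite eq_le outer_measure_ge0 andbT -B0.
exact: le_outer_measure.
Qed.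

Lemma ball_sub_box (x : V) (r : R) : (0 < r)%R ->
  ball x r `<=` box (x - const_mx r, x + const_mx r)%R.
Proof.
move=> r0 y /row_ballP-/(_ r0) xy i; have := xy i.
by rewrite !mxE ltr_distl => /andP[? ?]; apply/andP; split; lra.
Qed.

Lemma finite_vitali (s : seq (V * {posnum R})) :
  exists t, [/\ uniq t, {subset t <= s},
    (forall i j, i \in t -> j \in t -> i != j ->
       ball i.1 i.2%:num `&` ball j.1 j.2%:num = set0) &
    forall i, i \in s -> exists2 j, j \in t &
      ball i.1 i.2%:num `<=` ball j.1 (3 * j.2%:num)%R].
Proof.
have seq_max (q : seq (V * {posnum R})) : q != [::] -> exists2 i, i \in q &
    forall j, j \in q -> (j.2%:num <= i.2%:num)%R.
  case: q => // i0 q _; elim: q i0 => [|j q IH] k.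
    by exists k; rewrite ?mem_head// => j; rewrite inE => /eqP ->.
  have [l lr lmax] := IH j.
  have [kl|/ltW lk] := leP k.2%:num l.2%:num.
    exists l; first by rewrite in_cons lr orbT.
    by move=> u; rewrite in_cons => /orP[/eqP ->|/lmax].
  exists k; first exact: mem_head.
  by move=> u; rewrite in_cons => /orP[/eqP ->//|/lmax/le_trans]; apply.
have [m] := ubnP (size s); elim: m s => // m ih s; rewrite ltnS => sm.
have [->|/seq_max[i is_ imax]] := eqVneq s [::]; first by exists [::].
pose far (j : V * {posnum R}) := `[< ball j.1 j.2%:num `&` ball i.1 i.2%:num = set0 >].
have ifar : far i = false.
  apply/asboolPn; rewrite setIid => /seteqP[+ _] => /(_ i.1); apply.
  exact: ballxx.
have [|t [ut ts dt cov]] := ih [seq j <- s | far j].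
  apply: leq_trans sm; rewrite size_filter -(count_predC far s) -addn1 leq_add2l.
  by rewrite -has_count; apply/hasP; exists i => //=; rewrite ifar.
have tfar j : j \in t -> far j by move=> /ts; rewrite mem_filter => /andP[].
exists (i :: t); split.
- by rewrite /= ut andbT; apply/negP => /tfar; rewrite ifar.
- move=> j; rewrite in_cons => /orP[/eqP -> //|/ts].
  by rewrite mem_filter => /andP[].
- move=> j k; rewrite !in_cons => /orP[/eqP ->|jt] /orP[/eqP ->|kt].
  + by rewrite eqxx.
  + by move=> _; rewrite setIC; apply/asboolP; exact: tfar.
  + by move=> _; apply/asboolP; exact: tfar.
  + exact: dt.
- move=> j js; have [jfar|/asboolPn/eqP/set0P[z [jz iz]]] := boolP (far j).
    have [|k kt jk] := cov j; first by rewrite mem_filter jfar.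
    by exists k => //; rewrite in_cons kt orbT.
  exists i; first exact: mem_head.
  move=> y jy; have ij := imax j js.
  (* The common point [z] puts [y] within [r_i + 2 r_j] of the centre of [i], and [r_j <= r_i]. *)
  apply: (@le_ball _ _ i.1 (i.2%:num + j.2%:num + j.2%:num)%R); first by lra.
  apply: ball_triangle jy; apply: (ball_triangle iz); exact: ball_sym.
Qed.

(** Continuity from below, relative to an arbitrary set [S]: the successive differences are disjoint
    Caratheodory sets, so the partial sums of their measures are the measures of the finite
    unions. *)
Lemma outer_bigcup_le (S : set V) (F : nat -> set V) (C : \bar R) :
  (forall k, mu.-caratheodory (F k)) ->
  (forall m, mu (S `&` \big[setU/set0]_(k < m) F k) <= C) ->
  mu (S `&` \bigcup_k F k) <= C.
Proof.
move=> mF FC; pose G m := \big[setU/set0]_(k < m.+1) F k.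
have ndG : nondecreasing_seq G.
  by move=> k m km; apply/subsetPset; exact: subset_bigsetU.
have mG k : mu.-caratheodory (seqD G k).
  case: k => [|k] /=; first exact: caratheodory_measurable_bigsetU.
  by apply: caratheodory_measurable_setD; exact: caratheodory_measurable_bigsetU.
rewrite -eq_bigcup_seqD_bigsetU.
apply: (le_trans (outer_measure_bigcup_lim mu (seqD G) S)).
apply: lime_le; first by apply: is_cvg_nneseries => k _ _; exact: outer_measure_ge0.
apply: nearW => m; rewrite big_mkord -caratheodory_additive//; last exact: trivIset_seqD.
apply: le_trans (FC m); apply: le_outer_measure; apply: setIS.
rewrite -!bigcup_mkord => x [k /= km Dx].
have : G k x by case: k Dx {km} => [//|k] [].
rewrite /G -bigcup_mkord => -[l /= lk Fx]; exists l => //=.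
exact: leq_trans lk km.
Qed.

Lemma box_volume_cube (x : V) (a : R) : (0 <= a)%R ->
  box_volume (x - const_mx a, x + const_mx a)%R = ((2 * a) ^+ n)%R.
Proof.
move=> a0; rewrite /box_volume (eq_bigr (fun=> 2 * a)%R) => [|i _].
  by rewrite prodr_const card_ord.
by rewrite !mxE max_r; lra.
Qed.

(** Abstract form of a mass that is negligible on [A]: superadditive over disjoint balls and small
    on some open neighbourhood of each bounded part of [A]. It will be the integral over levels
    above [q], and then [mu] restricted to the complement of [A]. *)
Variables (nu : set V -> \bar R) (A : set V).
Hypothesis nu_ge0 : forall E, 0 <= nu E.
Hypothesis nu_sum : forall (s : seq (V * {posnum R})) (U : set V), open U ->
  uniq s ->
  (forall i j, i \in s -> j \in s -> i != j ->
     ball i.1 i.2%:num `&` ball j.1 j.2%:num = set0) ->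
  (forall i, i \in s -> ball i.1 i.2%:num `<=` U) ->
  \sum_(i <- s) nu (ball i.1 i.2%:num) <= nu U.
Hypothesis nu_small : forall (k : nat) (e : R), (0 < e)%R ->
  exists U, [/\ open U, A `&` ball 0%R k%:R `<=` U & nu U <= e%:E].

Let bad (c : R) (k : nat) : set V := [set x | (A `&` ball 0%R k%:R) x /\
  forall d : R, (0 < d)%R ->
    exists2 r : R, (0 < r < d)%R & (c * r ^+ n)%:E < nu (ball x r)].

(* Vitali: the balls on which [nu] is large are disjoint up to a dilation, and
   all lie in an open set carrying little of [nu]. *)
Let bad_null (c : R) (k : nat) : (0 < c)%R -> mu (bad c k) = 0.
Proof.
move=> c0; apply/eqP; rewrite eq_le outer_measure_ge0 andbT.
apply/lee_addgt0Pr => e e0; rewrite add0e.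
(* The threefold dilation of a sup-norm ball of radius [r] has volume [(6 r) ^ n], while the ball
   itself has [nu] above [c r ^ n]. *)
pose K : R := (6 ^+ n / c)%R.
have K0 : (0 < K)%R by rewrite divr_gt0// exprn_gt0.
have [U [oU AU Ue]] := nu_small k (divr_gt0 e0 K0).
pose B (i : V * {posnum R}) : set V := ball i.1 i.2%:num.
pose W : set (V * {posnum R}) := [set i |
  [/\ bad c k i.1, B i `<=` U & (c * i.2%:num ^+ n)%:E < nu (B i)]].
(* One ball is chosen for each dyadic cube contained in a ball of [W]; these countably many balls
   still cover the bad points. *)
pose P : set (int * {ffun 'I_n -> int}) :=
  [set p | exists2 i, W i & dyadic_cube (lattice_cube p) `<=` B i].
have [g Pg] : {g : int * {ffun 'I_n -> int} -> V * {posnum R} & forall p, P p ->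
    W (g p) /\ dyadic_cube (lattice_cube p) `<=` B (g p)}.
  apply: (@choice _ _ (fun p i => P p ->
    W i /\ dyadic_cube (lattice_cube p) `<=` B i)) => p.
  have [[i Wi pi]|nP] := pselect (P p); first by exists i.
  by exists (0%R, 1%:pos%R).
have [N [f [fN _ fP]]] := countable_enum (0%R, [ffun=> 0%R]) (countableP P).
pose F k := if k \in N then B (g (f k)) else set0.
have badF : bad c k `<=` \bigcup_k F k.
  move=> x xbad; have [AkX xr] := xbad.
  have Ux : U x by exact: AU.
  move: (oU); rewrite openE => /(_ _ Ux); rewrite /interior -nbhs_ballE.
  move=> [d /= d0 dU].
  have [r /andP[r0 rd] rnu] := xr d d0.
  have [l lr] := small_scale r0.
  have Px : P (cube_around l x).
    exists (x, PosNum r0).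
      by split=> //=; apply: subset_trans dU; apply: le_ball; exact: ltW.
    move=> y ly; apply/row_ballP => // i.
    by apply: lt_trans lr; apply: (cube_diam _ (cube_aroundP l x) ly).
  have [j Nj fj] := fP _ Px; exists j => //.
  rewrite /F mem_set// fj; apply: (Pg _ Px).2; exact: cube_aroundP.
apply: (le_trans (le_outer_measure mu _ _ badF)).
(* Continuity from below reduces the estimate to finite unions, where the finite Vitali selection
   applies. *)
rewrite -[\bigcup_k F k]setTI; apply: outer_bigcup_le.
  move=> l; rewrite /F; case: ifP => _; last exact: caratheodory_measurable_set0.
  exact/open_caratheodory/ball_open.
move=> m; rewrite setTI.
have [t [ut ts dt cov]] :=
  finite_vitali [seq g (f l) | l <- iota 0 m & l \in N].
have tW i : i \in t -> W i.
  move=> /ts/mapP[l]; rewrite mem_filter => /andP[/set_mem/fN/Pg[Wi _] _] ->.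
  exact: Wi.
have Ft : \big[setU/set0]_(k < m) F k `<=` \bigcup_(i in [set` t])
    box (i.1 - const_mx (3 * i.2%:num), i.1 + const_mx (3 * i.2%:num))%R.
  rewrite -bigcup_mkord => x [l /= lm]; rewrite /F; case: ifPn => // Nl Bx.
  have [|j jt ij] := cov (g (f l)).
    by apply: map_f; rewrite mem_filter Nl mem_iota add0n.
  exists j => //; apply: ball_sub_box; [exact: mulr_gt0|exact: ij].
have fint : finite_set [set` t] by exact: finite_seq.
apply: (le_trans (lebesgue_outer_le_cover (0%R, 1%:pos%R)
  (finite_set_countable fint) Ft)).
apply: (@le_trans _ _ (K%:E * nu U)); last first.
  apply: (@le_trans _ _ (K%:E * (e / K)%:E)).
    by rewrite lee_pmul2l// lte_fin.
  by rewrite -EFinM mulrC divfK// gt_eqF.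
rewrite esum_fset//; last by move=> i _; rewrite lee_fin box_volume_ge0.
rewrite -fsbig_seq//.
apply: (@le_trans _ _ (K%:E * \sum_(i <- t) nu (B i))); last first.
  rewrite lee_pmul2l ?lte_fin//; apply: nu_sum => //.
  by move=> i /tW[].
rewrite ge0_sume_distrr//.
rewrite big_seq [leRHS]big_seq; apply: lee_sum => i /tW[_ _ /ltW ci].
apply: (@le_trans _ _ (K%:E * (c * i.2%:num ^+ n)%:E)); last first.
  by rewrite lee_pmul2l ?lte_fin.
rewrite box_volume_cube ?mulr_ge0// -EFinM lee_fin mulrA exprMn -natrM.
by rewrite /K mulrA divfK ?gt_eqF.
Qed.

(** On [A], [nu] is almost everywhere of order [o(r ^ n)] on balls of radius [r]. Bad sets shrink as
    [c] grows, so the constants [1 / (j + 1)] and integer radii [k] give a countable union. *)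
Lemma ae_small_average : exists2 Z, mu Z = 0 & forall x, A x -> ~ Z x ->
  forall c : R, (0 < c)%R -> exists2 d : R, (0 < d)%R &
    forall r : R, (0 < r < d)%R -> nu (ball x r) <= (c * r ^+ n)%:E.
Proof.
exists (\bigcup_(p : nat * nat) bad p.1.+1%:R^-1 p.2).
  apply: (outer_null_bigcup (0%N, 0%N)) => p; apply: bad_null.
  by rewrite invr_gt0.
move=> x Ax nZx c c0.
pose k := Num.bound `|x|; pose j := Num.bound c^-1.
have xk : ball (0 : V)%R k%:R x.
  by rewrite -ball_normE /ball_/= sub0r normrN archi_boundP.
have jc : (j.+1%:R^-1 < c)%R.
  rewrite -[ltRHS]invrK ltf_pV2 ?posrE ?invr_gt0//.
  apply: (lt_trans (archi_boundP _)); rewrite ?invr_ge0 ?ltW//.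
  by rewrite ltr_nat.
apply: contrapT => nd; apply: nZx; exists (j, k) => //; split=> // d d0.
apply: contrapT => nr; apply: nd; exists d => // r rd.
have r0 : (0 < r)%R by case/andP: rd.
rewrite leNgt; apply/negP => crnu; apply: nr; exists r => //.
apply: le_lt_trans crnu; rewrite lee_fin ler_wpM2r ?exprn_ge0 ?ltW//.
Qed.

End differentiation_of_null_parts.

(** * Euclidean balls *)

Section euclidean_balls.
Context {R : realType} {n : nat}.
Local Notation mu := (@lebesgue_outer R n).
Local Notation V := 'rV[R]_n.

Lemma euclid_ballP (x y : V) (r : R) : (0 < r)%R ->
  euclid_ball x r y <-> (\sum_(i < n) (x ord0 i - y ord0 i) ^+ 2 < r ^+ 2)%R.
Proof.
move=> r0; rewrite /euclid_ball /euclid_dist /=.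
set S := (\sum_(i < n) _)%R.
have S0 : (0 <= S)%R by apply: sumr_ge0 => i _; exact: sqr_ge0.
rewrite -{2}(sqr_sqrtr S0) ltr_pXn2r ?nnegrE ?sqrtr_ge0//; exact: ltW.
Qed.

Lemma euclid_ball_sym (x y : V) (r : R) : euclid_ball x r y -> euclid_ball y r x.
Proof.
rewrite /euclid_ball /euclid_dist /=; congr (Num.sqrt _ < r)%R.
by apply: eq_bigr => i _; rewrite -sqrrN opprB.
Qed.

Lemma le_euclid_ball (x : V) (r s : R) : (r <= s)%R ->
  euclid_ball x r `<=` euclid_ball x s.
Proof. by move=> rs y; rewrite /euclid_ball/= => /lt_le_trans; exact. Qed.

Lemma euclid_ball_coord (x y : V) (r : R) i : (0 < r)%R ->
  euclid_ball x r y -> (`|x ord0 i - y ord0 i| < r)%R.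
Proof.
move=> r0 /euclid_ballP-/(_ r0) xy.
rewrite -(ltr_pXn2r (ltn0Sn 1)) ?nnegrE ?(ltW r0)//.
rewrite -normrX ger0_norm ?sqr_ge0//; apply: le_lt_trans xy.
by rewrite (bigD1 i)//= lerDl sumr_ge0// => j _; exact: sqr_ge0.
Qed.

Lemma euclid_ball_sub (x : V) (r : R) : (0 < r)%R ->
  euclid_ball x r `<=` ball x r.
Proof.
by move=> r0 y xy; apply/row_ballP => // i; exact: euclid_ball_coord.
Qed.

(** For [a = r / (2 (n + 1))] the sum of [n] squares bounded by [a ^ 2] is below [r ^ 2], since
    [n < (2 (n + 1)) ^ 2]. *)
Lemma box_sub_euclid_ball (x : V) (r : R) : (0 < r)%R ->
  box (x - const_mx (r / (2 * n.+1%:R)), x + const_mx (r / (2 * n.+1%:R)))%R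
  `<=` euclid_ball x r.
Proof.
move=> r0; set a := (r / _)%R => y xy; apply/euclid_ballP => //.
have n0 : (0 < n.+1%:R :> R)%R by [].
have a0 : (0 < a)%R by rewrite divr_gt0// mulr_gt0.
have ra : (r = a * (2 * n.+1%:R))%R by rewrite divfK// gt_eqF// mulr_gt0.
clearbody a; apply: (@le_lt_trans _ _ (\sum_(i < n) a ^+ 2)%R).
  apply: ler_sum => i _; have := xy i; rewrite !mxE => /andP[? ?].
  have xya : (`|x ord0 i - y ord0 i| <= a)%R.
    by rewrite ler_norml; apply/andP; split; lra.
  rewrite -[leLHS]real_normK ?num_real//.
  by rewrite lerXn2r ?nnegrE// ltW.
rewrite sumr_const card_ord ra exprMn -[ltLHS]mulr_natr.
rewrite ltr_pM2l ?exprn_gt0//.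
apply: (@lt_le_trans _ _ (n.+1%:R)%R); first by rewrite ltr_nat.
rewrite exprMn -!natrX -natrM ler_nat.
by rewrite -[X in (X <= _)%N]mul1n leq_mul// expnS leq_pmulr// expn_gt0.
Qed.

(* Replaces the Euclidean triangle inequality. *)
Lemma euclid_ball_near (x : V) (s r : R) : (0 < s < r)%R ->
  exists2 d : R, (0 < d)%R &
    forall y, ball x d y -> euclid_ball x s `<=` euclid_ball y r.
Proof.
move=> /andP[s0 sr]; have r0 : (0 < r)%R by exact: lt_trans sr.
(* Moving the centre by less than [d <= 1] in each coordinate raises each square by at most
   [d (2 s + 1)], hence the sum by at most [d K]. *)
pose K : R := (n.+1%:R * (2 * s + 1))%R.
have K0 : (0 < K)%R by rewrite mulr_gt0//; lra.
have rs0 : (0 < r ^+ 2 - s ^+ 2)%R.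
  by rewrite subr_gt0 ltr_pXn2r ?nnegrE// ltW.
pose d := (Num.min 1 ((r ^+ 2 - s ^+ 2) / K))%R.
have d0 : (0 < d)%R by rewrite lt_min ltr01 divr_gt0.
have d1 : (d <= 1)%R by rewrite ge_min lexx.
have dK : (d * K <= r ^+ 2 - s ^+ 2)%R.
  by rewrite -ler_pdivlMr// ge_min lexx orbT.
exists d => // y /row_ballP-/(_ d0) xy z xz; apply/euclid_ballP => //.
have xzi i := euclid_ball_coord i s0 xz.
apply: (@le_lt_trans _ _
  (\sum_(i < n) ((x ord0 i - z ord0 i) ^+ 2 + d * (2 * s + 1)))%R).
  apply: ler_sum => i _; have := xzi i; have := xy i.
  rewrite !ltr_norml => /andP[v1 v2] /andP[u1 u2].
  set u := (x ord0 i - z ord0 i)%R; set v := (x ord0 i - y ord0 i)%R.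
  have -> : (y ord0 i - z ord0 i = u - v)%R by rewrite /u /v opprB [RHS]addrC addrA subrK.
  (* These products yield [- u v <= s d] and [v ^ 2 <= d ^ 2 <= d], which bound [(u - v) ^ 2]. *)
  have p1 : (0 <= (s + u) * (d + v))%R by rewrite mulr_ge0//; rewrite /u /v; lra.
  have p2 : (0 <= (s - u) * (d - v))%R by rewrite mulr_ge0//; rewrite /u /v; lra.
  have p3 : (0 <= (d + v) * (d - v))%R by rewrite mulr_ge0//; rewrite /v; lra.
  have p4 : (0 <= d * (1 - d))%R by rewrite mulr_ge0//; lra.
  by clearbody u v d; lra.
rewrite big_split/= sumr_const card_ord -mulr_natr.
move: xz => /euclid_ballP-/(_ s0) xz.
have : (d * (2 * s + 1) * n%:R <= d * K)%R.
  by rewrite /K -mulrA ler_pM2l// mulrC ler_pM2r ?ler_nat//; lra.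
lra.
Qed.

Lemma open_euclid_ball (x : V) (r : R) : (0 < r)%R -> open (euclid_ball x r).
Proof.
move=> r0; rewrite openE => y xy; rewrite /interior -nbhs_ballE.
(* A radius strictly between the distance and [r]: the ball of radius [s] about [y] contains [x],
   hence so do the balls of radius [r] about nearby centres. *)
pose s := ((Num.max 0 (euclid_dist x y) + r) / 2)%R.
have m0 : (0 <= Num.max 0 (euclid_dist x y))%R by rewrite le_max lexx.
have mr : (Num.max 0 (euclid_dist x y) < r)%R.
  by rewrite gt_max r0; exact: xy.
have sr : (0 < s < r)%R by rewrite /s; apply/andP; split; lra.
have [d d0 dy] := euclid_ball_near y sr.
exists d => //= z /dy yz; apply/euclid_ball_sym/yz/euclid_ball_sym.
rewrite /euclid_ball/=; apply: (@le_lt_trans _ _ (Num.max 0 (euclid_dist x y))%R).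
  by rewrite le_max lexx orbT.
by rewrite /s; lra.
Qed.

Lemma outer_shift (E : set V) (v : V) : mu [set z | E (z - v)%R] <= mu E.
Proof.
apply: le_ereal_inf_tmp => _ [D [C [EC ->]]].
apply: ereal_inf_lbound; exists D, (fun i => ((C i).1 + v, (C i).2 + v))%R.
split.
  move=> z /EC[i Di zi]; exists i => // j; have := zi j; rewrite !mxE.
  by move=> /andP[? ?]; apply/andP; split; lra.
apply: eq_esum => i _; congr EFin; apply: eq_bigr => j _.
by rewrite !mxE; congr (Num.max _ _); lra.
Qed.

(** Makes the normalising factor of the averages independent of the centre, as needed for their
    semicontinuity. *)
Lemma outer_euclid_ball_shift (x y : V) (r : R) :
  mu (euclid_ball x r) = mu (euclid_ball y r).
Proof.
suff le_ball_ u w : mu (euclid_ball u r) <= mu (euclid_ball w r).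
  by apply/eqP; rewrite eq_le !le_ball_.
apply: le_trans (outer_shift (euclid_ball w r) (u - w)%R).
apply: le_outer_measure => z; rewrite /euclid_ball /euclid_dist/=.
congr (Num.sqrt _ < r)%R; apply: eq_bigr => i _.
by rewrite !mxE; congr (_ ^+ 2)%R; lra.
Qed.

Lemma outer_ball_fin (x : V) (r : R) : (0 < r)%R -> mu (ball x r) < +oo.
Proof.
move=> r0; apply: le_lt_trans (ltry _).
exact: le_trans (le_outer_measure mu _ _ (ball_sub_box r0))
  (lebesgue_outer_box_le _).
Qed.

(** Volume of a cube of side [1 / (n + 1)] inside the Euclidean unit ball; it turns bounds by
    [r ^ n] into bounds by ball volumes. *)
Definition ball_ratio : R := (n.+1%:R^-1 ^+ n)%R.

Lemma ball_ratio_gt0 : (0 < ball_ratio)%R.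
Proof. by rewrite exprn_gt0// invr_gt0. Qed.

Lemma outer_euclid_ball_ge (x : V) (r : R) : (0 < r)%R ->
  (ball_ratio * r ^+ n)%:E <= mu (euclid_ball x r).
Proof.
move=> r0; apply: le_trans (le_outer_measure mu _ _ (box_sub_euclid_ball r0)).
rewrite [leRHS]lebesgue_outer_box box_volume_cube; last first.
  by rewrite ltW// divr_gt0// mulr_gt0.
rewrite lee_fin /ball_ratio -exprMn le_eqVlt; apply/orP; left; apply/eqP.
congr (_ ^+ n)%R; by rewrite invfM [RHS]mulrCA mulVKf// mulrC.
Qed.

Lemma outer_euclid_ball_fin (x : V) (r : R) : (0 < r)%R ->
  mu (euclid_ball x r) \is a fin_num.
Proof.
move=> r0; rewrite ge0_fin_numE ?outer_measure_ge0//.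
apply: le_lt_trans (outer_ball_fin x r0).
exact/le_outer_measure/euclid_ball_sub.
Qed.

Lemma outer_euclid_ball_gt0 (x : V) (r : R) : (0 < r)%R ->
  0 < mu (euclid_ball x r).
Proof.
move=> r0; apply: lt_le_trans (outer_euclid_ball_ge x r0).
by rewrite lte_fin mulr_gt0 ?ball_ratio_gt0// exprn_gt0.
Qed.

End euclidean_balls.

(** * Averages of the Choquet integral *)

Section limsup_at_zero.
Context {R : realType}.
Implicit Types (F : R -> \bar R) (y : \bar R).

Lemma limf_esup_at0_le F y (d : R) : (0 < d)%R ->
  (forall r, (0 < r < d)%R -> F r <= y) -> limf_esup F (0%R : R)^'+ <= y.
Proof.
move=> d0 Fy; have W : \forall r \near (0%R : R)^'+, `]0%R, d[%classic r.
  near=> r; rewrite /= in_itv/=; apply/andP; split; near: r.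
    exact: nbhs_right_gt.
  exact: nbhs_right_lt.
apply: (@le_trans _ _ (ereal_sup (F @` `]0%R, d[%classic))).
  by apply: ereal_inf_lbound; exists `]0%R, d[%classic.
by apply: ge_ereal_sup => _ [r /= + <-]; rewrite in_itv/= => /Fy.
Unshelve. all: by end_near. Qed.

Lemma limf_esup_at0_ge F y (d : R) : (0 < d)%R ->
  (forall r, (0 < r < d)%R -> y <= F r) -> y <= limf_esup F (0%R : R)^'+.
Proof.
move=> d0 Fy; apply: le_ereal_inf_tmp => _ [W W0 <-].
have [r [Wr rd]] : exists r : R, W r /\ (0 < r < d)%R.
  near (0%R : R)^'+ => r; exists r; split; first by near: r.
  by apply/andP; split; near: r; [exact: nbhs_right_gt|exact: nbhs_right_lt].
by apply: le_trans (Fy _ rd) _; apply: ereal_sup_ubound; exists r.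
Unshelve. all: by end_near. Qed.

(** The intervals [(0, 1 / (k + 1))] form a countable base of the filter, so the upper limit is a
    countable infimum and measurability can pass to it. *)
Lemma limf_esup_at0E F : limf_esup F (0%R : R)^'+ =
  ereal_inf (range (fun k : nat =>
    ereal_sup [set F r | r in [set r : R | 0 < r < k.+1%:R^-1]%R])).
Proof.
apply/eqP; rewrite eq_le; apply/andP; split.
  apply: le_ereal_inf_tmp => _ [k _ <-].
  apply: (@limf_esup_at0_le _ _ (k.+1%:R^-1)%R); first by rewrite invr_gt0.
  by move=> r rk; apply: ereal_sup_ubound; exists r.
apply: le_ereal_inf_tmp => _ [W W0 <-].
have [e /= e0 eW] : exists2 e : R, (0 < e)%R & forall r, (0 < r < e)%R -> W r.
  move: W0; rewrite /at_right /within /= -nbhs_ballE => -[e /= e0 eW].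
  exists e => // r /andP[r0 re]; apply: eW => //.
  by rewrite /ball/= sub0r normrN gtr0_norm.
pose k := Num.bound e^-1.
have ke : (k.+1%:R^-1 < e)%R.
  rewrite -[ltRHS]invrK ltf_pV2 ?posrE ?invr_gt0//.
  apply: (lt_trans (archi_boundP _)); rewrite ?invr_ge0 ?ltW//.
  by rewrite ltr_nat.
apply: le_trans; first by apply: ereal_inf_lbound; exists k.
apply: ereal_sup_le => _ [r /= /andP[r0 rk] <-]; exists r => //.
by apply: eW; rewrite r0 (lt_trans rk ke).
Qed.

Lemma rat_between_ereal (a b : \bar R) : 0 <= a -> a < b ->
  exists q : rat, a < (ratr q)%:E < b.
Proof.
case: a => [a| |]// _; last by rewrite ltNge leey.
case: b => [b ab|_|]//.
  have /rat_in_itvoo[q] : (a < b)%R by rewrite -lte_fin.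
  by rewrite in_itv/= => qab; exists q; rewrite !lte_fin.
have /rat_in_itvoo[q] : (a < a + 1)%R by rewrite ltrDl.
by rewrite in_itv/= => /andP[aq _]; exists q; rewrite lte_fin aq ltry.
Qed.

End limsup_at_zero.

(** * Integrals over ranges of levels, and the averages of [f] over Euclidean balls *)

Section choquet_averages.
Context {R : realType} {n : nat}.
Local Notation mu := (@lebesgue_outer R n).
Local Notation V := 'rV[R]_n.
Variable f : V -> \bar R.
Hypothesis f_ge0 : forall x, 0 <= f x.
Hypothesis f_int : forall (x : V) (r : R), (0 < r)%R ->
  choquet_integral n%:R (euclid_ball x r) f < +oo.

Let above (t : R) : set V := [set x | t%:E < f x].

(** The part of the Choquet integral coming from levels in [I], seen as a set function of [E]. *)
Let tail (I : set R) (E : set V) : \bar R :=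
  \int[lebesgue_measure]_(t in I) mu (E `&` above t).

Let above_meas (D : set R) (E : set V) : measurable D ->
  measurable_fun D (fun t => mu (E `&` above t)).
Proof.
move=> mD; apply: nonincreasing_emeasurable => // s t st.
apply: le_outer_measure; apply: setIS => x; rewrite /above/=.
by apply: le_lt_trans; rewrite lee_fin.
Qed.

Let choquet_tail (E : set V) :
  choquet_integral n%:R E f = tail `]0%R, +oo[%classic E.
Proof. by apply: eq_integral => t _; rewrite dyadic_contentE. Qed.

Let tail_ge0 I E : 0 <= tail I E.
Proof. by apply: integral_ge0 => t _; exact: outer_measure_ge0. Qed.

Let le_tail I (E F : set V) : measurable I -> E `<=` F -> tail I E <= tail I F.
Proof.
move=> mI EF; apply: ge0_le_integral => //.
- by move=> t _; exact: outer_measure_ge0.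
- exact: above_meas.
- exact: above_meas.
- by move=> t _; apply: le_outer_measure; exact: setSI.
Qed.

Let sub_tail (I J : set R) (E : set V) : measurable I -> measurable J ->
  I `<=` J -> tail I E <= tail J E.
Proof.
move=> mI mJ IJ; apply: ge0_subset_integral => //; first exact: above_meas.
by move=> t _; exact: outer_measure_ge0.
Qed.

(** Superadditivity holds at each level [t] and survives integration over [t]. *)
Let tail_sum (J : eqType) (I : set R) (s : seq J) (F : J -> set V) (U : set V) :
  measurable I -> uniq s ->
  (forall i, i \in s -> mu.-caratheodory (F i)) ->
  (forall i j, i \in s -> j \in s -> i != j -> F i `&` F j = set0) ->
  (forall i, i \in s -> F i `<=` U) ->
  \sum_(i <- s) tail I (F i) <= tail I U.
Proof.
move=> mI us mF dF FU; rewrite -ge0_integral_sum//; last 2 first.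
- by move=> i; exact: above_meas.
- by move=> i t _; exact: outer_measure_ge0.
apply: ge0_le_integral => //.
- by move=> t _; apply: sume_ge0 => i _; exact: outer_measure_ge0.
- by apply: emeasurable_sum => i; exact: above_meas.
- exact: above_meas.
- move=> t _; under eq_bigr do rewrite setIC.
  by rewrite [X in _ <= mu X]setIC; exact: sum_outer_measure_le.
Qed.

Let ball_sub_euclid (x : V) (r : R) : (0 < r)%R ->
  ball x r `<=` euclid_ball x (r * (2 * n.+1%:R))%R.
Proof.
move=> r0; apply: (subset_trans (ball_sub_box r0)).
have n2 : (0 < 2 * n.+1%:R :> R)%R by rewrite mulr_gt0.
have := @box_sub_euclid_ball R n x (r * (2 * n.+1%:R))%R (mulr_gt0 r0 n2).
by rewrite mulfK// gt_eqF.
Qed.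

Let tail_ball_fin (I : set R) (x : V) (r : R) : measurable I ->
  I `<=` `]0%R, +oo[%classic -> (0 < r)%R -> tail I (ball x r) < +oo.
Proof.
move=> mI I0 r0; have n2 : (0 < r * (2 * n.+1%:R))%R by rewrite !mulr_gt0.
apply: le_lt_trans (f_int x n2); rewrite choquet_tail.
apply: (@le_trans _ _ (tail I (euclid_ball x (r * (2 * n.+1%:R))%R))).
  by apply: le_tail => //; exact: ball_sub_euclid.
exact: sub_tail.
Qed.

(** The Caratheodory splitting of [U] by [B] turns closeness of the measures into smallness of the
    difference, after cancelling the finite [mu B]. *)
Lemma outer_open_diff (B : set V) (e : R) : (0 < e)%R ->
  mu.-caratheodory B -> mu B < +oo ->
  exists U, [/\ open U, B `<=` U & mu (U `&` ~` B) <= e%:E].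
Proof.
move=> e0 mB Boo; have [U [oU BU Ue]] := outer_open_approx e0 Boo.
exists U; split=> //.
have Bfin : mu B \is a fin_num by rewrite ge0_fin_numE ?outer_measure_ge0.
by move: Ue; rewrite (mB U) (setIidr BU) leeD2lE.
Qed.

Let ball_natS (k : nat) : ball (0%R : V) k%:R `<=` ball (0%R : V) k.+1%:R.
Proof. by apply: le_ball; rewrite ler_nat. Qed.

Let bounded_part (A : set V) (k : nat) : mu.-caratheodory A ->
  let B := A `&` ball (0%R : V) k.+1%:R in mu.-caratheodory B /\ mu B < +oo.
Proof.
move=> mA B; split.
  by apply: caratheodory_measurable_setI => //; exact/open_caratheodory/ball_open.
apply: le_lt_trans (outer_ball_fin (0%R : V) (ltr0Sn R k)).
by apply: le_outer_measure; exact: subIsetr.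
Qed.

(* Dominated convergence in the level [t]: open sets shrinking to [A] meet
   [above t], which is disjoint from [A], in sets of vanishing measure. *)
Let tail_small (I : set R) (A : set V) (k : nat) (e : R) : measurable I ->
  I `<=` `]0%R, +oo[%classic -> mu.-caratheodory A ->
  (forall t, I t -> A `&` above t = set0) -> (0 < e)%R ->
  exists U, [/\ open U, A `&` ball (0%R : V) k%:R `<=` U & tail I U <= e%:E].
Proof.
move=> mI I0 mA dA e0; have [mB Boo] := bounded_part k mA.
set K := ball (0%R : V) k.+1%:R in mB Boo.
have [U PU] := choice (fun j : nat =>
  @outer_open_diff _ (j.+1%:R^-1)%R ltac:(by rewrite invr_gt0) mB Boo).
(* Cutting with the bounded ball [K] provides the dominating function; its radius [k + 1] is
   positive even for [k = 0]. *)
pose W j := U j `&` K.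
have oW j : open (W j).
  by apply: openI; [have [] := PU j|exact: ball_open].
have AW j : A `&` ball (0%R : V) k%:R `<=` W j.
  move=> x [Ax /ball_natS Kx]; split=> //; have [_ + _] := PU j; apply.
  by split.
apply: contrapT => nU.
have big j : e%:E <= tail I (W j).
  by rewrite leNgt; apply/negP => /ltW je; apply: nU; exists (W j).
have small j t : I t -> mu (W j `&` above t) <= (j.+1%:R^-1)%:E.
  move=> It; have [_ _] := PU j; apply: le_trans; apply: le_outer_measure.
  move=> x [[Ux Kx] tx]; split=> // -[Ax _].
  by have : (A `&` above t) x by []; rewrite dA.
have to0 t : I t -> mu (W j `&` above t) @[j --> \oo] --> 0.
  move=> It; apply: (@squeeze_cvge _ _ _ _ (cst 0) _
    (fun j => (j.+1%:R^-1)%:E)).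
  - by apply: nearW => j; rewrite outer_measure_ge0/= small.
  - exact: cvg_cst.
  - by apply/fine_cvgP; split; [exact: nearW|exact: cvg_harmonic].
have iK : lebesgue_measure.-integrable I (fun t => mu (K `&` above t)).
  apply/integrableP; split; first exact: above_meas.
  under eq_integral do rewrite gee0_abs ?outer_measure_ge0//.
  by apply: tail_ball_fin.
have ae0 : {ae lebesgue_measure, forall t : R, I t ->
    (fun j => mu (W j `&` above t)) @ \oo --> (cst 0 : R -> \bar R) t}.
  by apply: aeW => t It; exact: to0.
have dom : {ae lebesgue_measure, forall (t : R) j, I t ->
    `|mu (W j `&` above t)| <= mu (K `&` above t)}.
  apply: aeW => t j It; rewrite gee0_abs ?outer_measure_ge0//.
  by apply: le_outer_measure; apply: setSI; exact: subIsetr.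
have [_ _ cvgW] := @dominated_convergence _ _ _ lebesgue_measure I mI
  (fun j t => mu (W j `&` above t)) (cst 0) (fun t => mu (K `&` above t))
  (fun j => above_meas _ mI) (measurable_cst _) ae0 iK dom.
have : e%:E <= \int[lebesgue_measure]_(t in I) (cst 0 t : \bar R).
  rewrite -(cvg_lim _ cvgW)//; apply: lime_ge.
    by apply/cvg_ex; eexists; exact: cvgW.
  by apply: nearW => j; exact: big.
by rewrite integral0 lee_fin leNgt e0.
Qed.

Let average (x : V) (r : R) : \bar R :=
  (dyadic_content n%:R (euclid_ball x r))^-1 *
  choquet_integral n%:R (euclid_ball x r) f.

Let ball_volume (x : V) (r : R) : R := fine (mu (euclid_ball x r)).

Let ball_volumeE (x : V) (r : R) : (0 < r)%R ->
  mu (euclid_ball x r) = (ball_volume x r)%:E.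
Proof. by move=> r0; rewrite fineK// outer_euclid_ball_fin. Qed.

Let ball_volume_gt0 (x : V) (r : R) : (0 < r)%R -> (0 < ball_volume x r)%R.
Proof. by move=> r0; rewrite -lte_fin -ball_volumeE// outer_euclid_ball_gt0. Qed.

Let ball_volume_ge (x : V) (r : R) : (0 < r)%R ->
  (ball_ratio (R := R) (n := n) * r ^+ n <= ball_volume x r)%R.
Proof. by move=> r0; rewrite -lee_fin -ball_volumeE// outer_euclid_ball_ge. Qed.

Let averageE (x : V) (r : R) : (0 < r)%R -> average x r =
  ((ball_volume x r)^-1)%:E * tail `]0%R, +oo[%classic (euclid_ball x r).
Proof.
move=> r0; rewrite /average dyadic_contentE ball_volumeE// inver choquet_tail.
by rewrite gt_eqF// ball_volume_gt0.
Qed.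

Let average_le (x : V) (r : R) (a : \bar R) : (0 < r)%R ->
  (average x r <= a) =
  (tail `]0%R, +oo[%classic (euclid_ball x r) <= (ball_volume x r)%:E * a).
Proof. by move=> r0; rewrite averageE// lee_pdivrMl// ball_volume_gt0. Qed.

Let average_ge (x : V) (r : R) (a : \bar R) : (0 < r)%R ->
  (a <= average x r) =
  ((ball_volume x r)%:E * a <= tail `]0%R, +oo[%classic (euclid_ball x r)).
Proof. by move=> r0; rewrite averageE// lee_pdivlMl// ball_volume_gt0. Qed.

Let tail_cst (I : set R) (E : set V) (a : \bar R) : measurable I ->
  (forall t, I t -> mu (E `&` above t) <= a) ->
  tail I E <= a * lebesgue_measure I.
Proof.
move=> mI Ea; rewrite -integral_cst//; apply: ge0_le_integral => //.
- by move=> t _; exact: outer_measure_ge0.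
- exact: above_meas.
Qed.

Let cst_tail (I : set R) (E : set V) (a : \bar R) : measurable I -> 0 <= a ->
  (forall t, I t -> a <= mu (E `&` above t)) ->
  a * lebesgue_measure I <= tail I E.
Proof.
move=> mI a0 Ea; rewrite -integral_cst//; apply: ge0_le_integral => //.
exact: above_meas.
Qed.

(** Levels up to [q] contribute at most [q] times the volume of the ball; the integral over higher
    levels is negligible near almost every point of the set where [f <= q]. *)
Let ae_average_le (q : R) : (0 < q)%R ->
  mu.-caratheodory [set x | f x <= q%:E] ->
  exists2 Z, mu Z = 0 & forall x, f x <= q%:E -> ~ Z x ->
  forall e : R, (0 < e)%R -> exists2 d : R, (0 < d)%R &
    forall r : R, (0 < r < d)%R -> average x r <= (q + e)%:E.
Proof.
move=> q0 mA; set A := [set x | _] in mA.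
pose I := `]q, +oo[%classic.
have mI : measurable I by exact: measurable_itv.
have I0 : I `<=` `]0%R, +oo[%classic.
  by move=> t; rewrite /I/= !in_itv/= !andbT; exact: lt_trans.
have dA t : I t -> A `&` above t = set0.
  rewrite /I/= in_itv/= andbT => qt; apply/seteqP; split=> // x [] /= xq tx.
  by have := lt_le_trans tx xq; rewrite lte_fin ltNge ltW.
have [||k e e0|Z Z0 HZ] := @ae_small_average R n (tail I) A.
- by move=> E; exact: tail_ge0.
- move=> s U oU us dis sub; apply: tail_sum => //.
  by move=> i _; exact/open_caratheodory/ball_open.
- exact: tail_small.
exists Z => // x Ax nZx e e0.
have c0 := mulr_gt0 e0 (@ball_ratio_gt0 R n).
have [d d0 Hd] := HZ x Ax nZx _ c0; exists d => // r rd.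
have r0 : (0 < r)%R by case/andP: rd.
rewrite average_le//.
have -> : tail `]0%R, +oo[%classic (euclid_ball x r) =
    tail `]0%R, q]%classic (euclid_ball x r) + tail I (euclid_ball x r).
  have IU : `]0%R, +oo[%classic = `]0%R, q]%classic `|` I.
    apply/seteqP; split=> t; rewrite /I/= !in_itv/= !andbT.
      by move=> t0; have [tq|qt] := leP t q; [left; rewrite t0|right].
    by case=> [/andP[]//|]; exact: lt_trans.
  rewrite /tail IU ge0_integral_setU//.
  - by rewrite -IU; apply: above_meas; exact: measurable_itv.
  - by move=> t _; exact: outer_measure_ge0.
  - apply/disj_setPS => t [] /=; rewrite /I/= !in_itv/= andbT => /andP[_ tq].
    by rewrite ltNge tq.
have [q0' e0'] := (ltW q0, ltW e0).
rewrite EFinD ge0_muleDr ?lee_fin//; apply: leeD.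
  have -> : q%:E = lebesgue_measure `]0%R, q]%classic.
    by rewrite lebesgue_measure_itv/= lte_fin q0 sube0.
  apply: tail_cst; first exact: measurable_itv.
  by move=> t _; rewrite -ball_volumeE//; apply: le_outer_measure; exact: subIsetl.
apply: (@le_trans _ _ (tail I (ball x r))).
  by apply: le_tail => //; exact: euclid_ball_sub.
apply: (le_trans (Hd r rd)); rewrite -EFinM lee_fin -mulrA mulrC.
by rewrite ler_pM2r// ball_volume_ge.
Qed.

(** Almost every point of [A] is a density point of [A], and every superlevel set for a level below
    [q] contains [A]; so the integral is at least [q] times the measure of the part of the ball in
    [A]. *)
Let ae_average_ge (q : R) : (0 < q)%R ->
  mu.-caratheodory [set x | q%:E <= f x] ->
  exists2 Z, mu Z = 0 & forall x, q%:E <= f x -> ~ Z x ->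
  forall e : R, (0 < e)%R -> exists2 d : R, (0 < d)%R &
    forall r : R, (0 < r < d)%R -> (q - e)%:E <= average x r.
Proof.
move=> q0 mA; set A := [set x | _] in mA.
have [||k e e0|Z Z0 HZ] := @ae_small_average R n (fun E => mu (~` A `&` E)) A.
- by move=> E; exact: outer_measure_ge0.
- move=> s U oU us dis sub; apply: sum_outer_measure_le => //.
  by move=> i _; exact/open_caratheodory/ball_open.
- have [mB Boo] := bounded_part k mA.
  have [U [oU BU Ue]] := outer_open_diff e0 mB Boo.
  exists U; split=> //.
    by apply: subset_trans BU; apply: setIS; exact: ball_natS.
  apply: le_trans Ue; apply: le_outer_measure => x [nAx Ux]; split=> //.
  by case.
exists Z => // x Ax nZx e e0.
(* A missing fraction [e / q] of the ball costs [e] after multiplication by [q]. *)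
have c0 := mulr_gt0 (divr_gt0 e0 q0) (@ball_ratio_gt0 R n).
have [d d0 Hd] := HZ x Ax nZx _ c0; exists d => // r rd.
have r0 : (0 < r)%R by case/andP: rd.
rewrite average_ge//; set E := euclid_ball x r; set m := ball_volume x r.
have mE : mu E = m%:E by exact: ball_volumeE.
have EAfin : mu (E `&` A) \is a fin_num.
  rewrite ge0_fin_numE ?outer_measure_ge0//; apply: le_lt_trans (ltry m).
  by rewrite -mE; apply: le_outer_measure; exact: subIsetl.
have Abig : ((m - e / q * m)%:E <= mu (E `&` A)).
  have : mu (E `&` ~` A) <= (e / q * m)%:E.
    apply: (@le_trans _ _ (mu (~` A `&` ball x r))).
      by rewrite setIC; apply: le_outer_measure; apply: setIS; exact: euclid_ball_sub.
    apply: (le_trans (Hd r rd)); rewrite lee_fin -[leLHS]mulrA ler_pM2l ?divr_gt0//.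
    exact: ball_volume_ge.
  have : mu E <= mu (E `&` A) + mu (E `&` ~` A) by exact: le_outer_measureIC.
  rewrite mE -(fineK EAfin); case: (mu (E `&` ~` A)) => [b| |]//.
  by rewrite -EFinD !lee_fin => ? ?; lra.
apply: (@le_trans _ _ (mu (E `&` A) * lebesgue_measure `]0%R, q[%classic)).
  rewrite lebesgue_measure_itv/= lte_fin q0 sube0.
  apply: (@le_trans _ _ ((m - e / q * m)%:E * q%:E)).
    by rewrite -!EFinM lee_fin mulrBl mulrBr mulrAC divfK ?gt_eqF// [(e * m)%R]mulrC.
  by rewrite lee_wpmul2r// lee_fin ltW.
apply: (@le_trans _ _ (tail `]0%R, q[%classic E)).
  apply: cst_tail; first exact: measurable_itv.
    exact: outer_measure_ge0.
  move=> t /=; rewrite in_itv/= => /andP[_ tq].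
  apply: le_outer_measure; apply: setIS => z /=.
  by apply: lt_le_trans; rewrite lte_fin.
apply: sub_tail; [exact: measurable_itv|exact: measurable_itv|].
by move=> t /=; rewrite !in_itv/= andbT => /andP[].
Qed.

(** The two one-sided estimates hold at all positive rational levels outside one null set; rationals
    strictly between [f x] and the upper limit then contradict them. *)
Lemma lebesgue_limsup_average : lebesgue_measurable_fun f ->
  exists2 Z, mu Z = 0 & forall x, ~ Z x ->
    f x = limf_esup (average x) (0%R : R)^'+.
Proof.
move=> mf.
have mle q : mu.-caratheodory [set x | f x <= q%:E].
  by have := emeasurable_fun_infty_c measurableT mf q%:E; rewrite setTI.
have mge q : mu.-caratheodory [set x | q%:E <= f x].
  by have := emeasurable_fun_c_infty measurableT mf q%:E; rewrite setTI.
have [Z ZP] : {Z : rat -> set V & forall q : rat, mu (Z q) = 0 /\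
    ((0 < ratr q :> R)%R -> forall x, f x <= (ratr q)%:E -> ~ Z q x ->
     forall e : R, (0 < e)%R -> exists2 d : R, (0 < d)%R &
     forall r : R, (0 < r < d)%R -> average x r <= (ratr q + e)%:E)}.
  apply: (@choice _ _ (fun (q : rat) (Y : set V) => mu Y = 0 /\
    ((0 < ratr q :> R)%R -> forall x, f x <= (ratr q)%:E -> ~ Y x ->
     forall e : R, (0 < e)%R -> exists2 d : R, (0 < d)%R &
     forall r : R, (0 < r < d)%R -> average x r <= (ratr q + e)%:E))) => q.
  have [q0|q0] := ltP 0%R (ratr q : R).
    by have [Y Y0 HY] := ae_average_le q0 (mle _); exists Y.
  by exists set0; split; [exact: outer_measure0|].
have [Y YP] : {Y : rat -> set V & forall q : rat, mu (Y q) = 0 /\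
    ((0 < ratr q :> R)%R -> forall x, (ratr q)%:E <= f x -> ~ Y q x ->
     forall e : R, (0 < e)%R -> exists2 d : R, (0 < d)%R &
     forall r : R, (0 < r < d)%R -> (ratr q - e)%:E <= average x r)}.
  apply: (@choice _ _ (fun (q : rat) (Y : set V) => mu Y = 0 /\
    ((0 < ratr q :> R)%R -> forall x, (ratr q)%:E <= f x -> ~ Y x ->
     forall e : R, (0 < e)%R -> exists2 d : R, (0 < d)%R &
     forall r : R, (0 < r < d)%R -> (ratr q - e)%:E <= average x r))) => q.
  have [q0|q0] := ltP 0%R (ratr q : R).
    by have [Y Y0 HY] := ae_average_ge q0 (mge _); exists Y.
  by exists set0; split; [exact: outer_measure0|].
exists (\bigcup_(q : rat) (Z q `|` Y q)).
  apply: (outer_null_bigcup 0%R) => q; apply/eqP.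
  rewrite eq_le outer_measure_ge0 andbT; apply: (@le_trans _ _ (mu (Z q) + mu (Y q))).
    exact: outer_measureU2.
  by rewrite (ZP q).1 (YP q).1 adde0.
move=> x nx.
have nZ q : ~ Z q x by move=> Zx; apply: nx; exists q => //; left.
have nY q : ~ Y q x by move=> Yx; apply: nx; exists q => //; right.
have avg0 r : (0 < r)%R -> 0 <= average x r.
  by move=> r0; rewrite average_ge// mule0 tail_ge0.
have L0 : 0 <= limf_esup (average x) (0%R : R)^'+.
  by apply: (limf_esup_at0_ge ltr01) => r /andP[r0 _]; exact: avg0.
apply/eqP; rewrite eq_le; apply/andP; split; rewrite leNgt; apply/negP.
(* With upper limit [< p < q < f x], the lower estimate at [q] with error [q - p] keeps the averages
   above [p]. *)
- move=> /(rat_between_ereal L0)[p /andP[Lp pf]].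
  have p0 : 0 <= (ratr p)%:E :> \bar R by exact: le_trans (ltW Lp).
  have [q /andP[pq qf]] := rat_between_ereal p0 pf.
  have q0 : (0 < ratr q :> R)%R by rewrite -lte_fin (le_lt_trans p0).
  rewrite lte_fin -subr_gt0 in pq.
  have [d d0 Hd] := (YP q).2 q0 x (ltW qf) (nY q) _ pq.
  rewrite subKr in Hd.
  by move: Lp; rewrite ltNge (limf_esup_at0_ge d0 Hd).
(* With [f x < q < p <] upper limit, the upper estimate at [q] with error [p - q] keeps the averages
   below [p]. *)
- move=> /(rat_between_ereal (f_ge0 x))[q /andP[fq qL]].
  have q0 : (0 < ratr q :> R)%R by rewrite -lte_fin (le_lt_trans (f_ge0 x)).
  have q0' : 0 <= (ratr q)%:E :> \bar R by rewrite lee_fin ltW.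
  have [p /andP[qp pL]] := rat_between_ereal q0' qL.
  rewrite lte_fin -subr_gt0 in qp.
  have [d d0 Hd] := (ZP q).2 q0 x (ltW fq) (nZ q) _ qp.
  rewrite subrKC in Hd.
  by move: pL; rewrite ltNge (limf_esup_at0_le d0 Hd).
Qed.

Let euclid_ball_exhaust (x : V) (r : R) : (0 < r)%R -> exists s : nat -> R,
  [/\ forall j, (0 < s j < r)%R, {homo s : i j / (i <= j)%N >-> (i <= j)%R} &
      euclid_ball x r `<=` \bigcup_j euclid_ball x (s j)].
Proof.
(* The shift by 2 keeps the radius positive at [j = 0]. *)
move=> r0; exists (fun j => r - r / j.+2%:R)%R; split.
- move=> j; apply/andP; split; last by rewrite ltrBlDr ltrDl divr_gt0.
  by rewrite subr_gt0 ltr_pdivrMr// ltr_pMr// ltr1n.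
- by move=> i j ij; rewrite lerB// ler_pM2l// lef_pV2 ?posrE// ler_nat.
move=> y xy; have gap : (0 < r - euclid_dist x y)%R by rewrite subr_gt0.
pose j := Num.bound (r / (r - euclid_dist x y))%R.
exists j => //; rewrite /euclid_ball/= ltrBrDr -ltrBrDl.
rewrite ltr_pdivrMr// mulrC -ltr_pdivrMr//.
apply: (lt_trans (archi_boundP _)); last by rewrite ltr_nat.
by rewrite divr_ge0// ltW.
Qed.

(* The Choquet integral over a ball is lower semicontinuous in the centre,
   whatever [f]: it is continuous along increasing unions of balls. *)
Lemma open_average_gt (r a : R) : (0 < r)%R ->
  open [set x | a%:E < average x r].
Proof.
move=> r0; rewrite openE => x /= ax; rewrite /interior.
pose I := `]0%R, +oo[%classic : set R.
have mI : measurable I by exact: measurable_itv.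
set m := ball_volume x r.
have [s [sr nds sU]] := euclid_ball_exhaust x r0.
(* Otherwise continuity of [mu] along the smaller balls at each level, with monotone convergence
   over the levels, would bound the integral over the whole ball. *)
have [j jm] : exists j, m%:E * a%:E < tail I (euclid_ball x (s j)).
  apply: contrapT => /forallNP nj; move: ax; rewrite ltNge average_le//.
  move=> /negP; apply; rewrite -/I -/m.
  pose g j t := mu (euclid_ball x (s j) `&` above t).
  have ndg t : nondecreasing_seq (g ^~ t).
    move=> i j ij; apply: le_outer_measure; apply: setSI.
    by apply: le_euclid_ball; exact: nds.
  have g0 j t : I t -> 0 <= g j t by move=> _; exact: outer_measure_ge0.
  have cvgI := @cvg_monotone_convergence _ _ _ lebesgue_measure I mI g
    (fun j => above_meas (euclid_ball x (s j)) mI) g0 (fun t _ => ndg t).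
  apply: (@le_trans _ _ (\int[lebesgue_measure]_(t in I) limn (g ^~ t))).
    apply: ge0_le_integral => //.
    - by move=> t _; exact: outer_measure_ge0.
    - exact: above_meas.
    - apply: (emeasurable_fun_cvg g).
        by move=> j; exact: above_meas.
      by move=> t _; exact: ereal_nondecreasing_is_cvgn.
    move=> t _; rewrite setIC.
    apply: (@le_trans _ _ (mu (above t `&` \bigcup_j euclid_ball x (s j)))).
      by apply: le_outer_measure; exact: setIS.
    apply: outer_bigcup_le.
      move=> j; apply/open_caratheodory/open_euclid_ball.
      by have /andP[] := sr j.
    move=> k; apply: (@le_trans _ _ (g k t)).
      rewrite /g setIC; apply: le_outer_measure; apply: setSI.
      elim/big_ind: _ => [y []|A B As Bs y [/As|/Bs]//|i _].
      by apply: le_euclid_ball; apply: nds; exact: ltnW.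
    rewrite (cvg_lim _ (ereal_nondecreasing_cvgn (ndg t)))//.
    by apply: ereal_sup_ubound; exists k.
  rewrite -(cvg_lim _ cvgI)//; apply: lime_le.
    by apply/cvg_ex; eexists; exact: cvgI.
  apply: nearW => j; rewrite leNgt; apply/negP; exact: nj.
have [d d0 dy] := euclid_ball_near x (sr j).
apply/nbhs_ballP; exists d; first exact: d0.
move=> y /dy sy; suff : a%:E < average y r by [].
rewrite ltNge average_le// -ltNge.
have -> : ball_volume y r = m by rewrite /m /ball_volume (outer_euclid_ball_shift y x).
by apply: (lt_le_trans jm); exact: le_tail.
Qed.

(** A supremum over radii, though uncountable, has open superlevel sets because each average does;
    the upper limit is a countable infimum of such suprema. *)
Lemma measurable_limsup_average :
  lebesgue_measurable_fun (fun x => limf_esup (average x) (0%R : R)^'+).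
Proof.
pose G (k : nat) (x : V) : \bar R :=
  ereal_sup [set average x r | r in [set r : R | 0 < r < k.+1%:R^-1]%R].
have mG k : measurable_fun [set: caratheodory_type mu]
    (G k : caratheodory_type mu -> \bar R).
  apply: emeasurable_fun_gt => a; rewrite setTI.
  apply: open_caratheodory.
  have -> : [set x | a%:E < G k x] =
      \bigcup_(r in [set r : R | 0 < r < k.+1%:R^-1]%R)
        [set x | a%:E < average x r].
    apply/seteqP; split=> x /=.
      by move=> /ereal_sup_gt[_ [r rk <-] ar]; exists r.
    move=> [r rk /= ar]; apply: (lt_le_trans ar).
    by apply: ereal_sup_ubound; exists r.
  by apply: bigcup_open => r /andP[r0 _]; exact: open_average_gt.
have := measurable_fun_einfs mG 0.
congr measurable_fun; apply/funext => x; rewrite limf_esup_at0E.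
congr ereal_inf; apply/seteqP; split=> [_ [k _ <-]|_ [k _ <-]]; by exists k.
Qed.

End choquet_averages.

(** * Changing a function on a null set *)

Section null_modification.
Context {R : realType} {n : nat}.
Local Notation mu := (@lebesgue_outer R n).
Local Notation V := 'rV[R]_n.

Lemma null_caratheodory (N : set V) : mu N = 0 -> mu.-caratheodory N.
Proof.
move=> N0; apply: le_caratheodory_measurable => X.
apply: (@le_trans _ _ (mu (X `&` N) + mu (X `&` ~` N))) => //.
have -> : mu (X `&` N) = 0 by apply: le_outer_null N0; exact: subIsetr.
by rewrite add0e; apply: le_outer_measure; exact: subIsetl.
Qed.

(** Superlevel sets of [f] and [g] differ only inside [N], and every subset of [N] is null, hence
    Caratheodory measurable. *)
Lemma lebesgue_measurable_fun_ae (f g : V -> \bar R) (N : set V) :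
  mu N = 0 -> (forall x, ~ N x -> f x = g x) ->
  lebesgue_measurable_fun g -> lebesgue_measurable_fun f.
Proof.
move=> N0 fg mg; apply: emeasurable_fun_gt => a; rewrite setTI.
have mga : mu.-caratheodory [set x | a%:E < g x].
  by have := emeasurable_fun_o_infty measurableT mg a%:E; rewrite setTI.
have -> : [set x | a%:E < f x] =
    [set x | a%:E < g x] `\` N `|` [set x | a%:E < f x] `&` N.
  apply/seteqP; split=> x /=.
    by move=> ax; have [Nx|nNx] := pselect (N x); [right|left; rewrite -fg].
  by case=> [[ax nNx]|[]//]; rewrite fg.
apply: caratheodory_measurable_setU.
  by apply: caratheodory_measurable_setD => //; exact: null_caratheodory.
by apply: null_caratheodory; apply: le_outer_null N0; exact: subIsetr.
Qed.

End null_modification.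

Theorem corollary1p1 (R : realType) (n : nat) (n_ge1 : (1 <= n)%N)
    (f : 'rV[R]_n -> \bar R) (f_ge0 : forall x, 0 <= f x)
    (f_int : forall (x : 'rV[R]_n) (r : R), (0 < r)%R ->
       choquet_integral n%:R (euclid_ball x r) f < +oo) :
  lebesgue_measurable_fun f <->
  content_ae n%:R (fun x : 'rV[R]_n =>
    f x = limf_esup
            (fun r : R => (dyadic_content n%:R (euclid_ball x r))^-1 *
                          choquet_integral n%:R (euclid_ball x r) f)
            (0%R : R)^'+).
Proof.
split=> [/(lebesgue_limsup_average f_ge0 f_int)[Z Z0 HZ]|[Z [Z0 HZ]]].
  by exists Z; rewrite dyadic_contentE.
apply: (lebesgue_measurable_fun_ae _ HZ).
  by rewrite -dyadic_contentE.
exact: measurable_limsup_average.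
Qed.
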